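(* Let $d\ge1$, let $K\subseteq\mathbb{R}^d$ be a $d$-dimensional convex body (a closed bounded convex set with nonempty interior), and for $\mathbf{v}\in\mathbb{R}^d$ let $\Omega_{\mathbf{v}+K}=\mathbb{Z}^d\cap(\mathbf{v}+K)$ and let $\mathcal{A}_{\mathbf{v}+K}$ be the family of all arithmetic progressions in $\Omega_{\mathbf{v}+K}$. Then, with constants $c_d,C_d>0$ depending only on $d$, \[ f(K)\le c_d\sup_{\mathbf{v}\in\mathbb{R}^d}\operatorname{disc}(\mathcal{A}_{\mathbf{v}+K}), \] and for every $\mathbf{v}\in\mathbb{R}^d$, \[ \operatorname{disc}(\mathcal{A}_{\mathbf{v}+K})\le C_d\sqrt{\log(1+|\Omega_{\mathbf{v}+K}|)}\cdot f(K). \] Moreover, if $K=-K$, then writing $\mathcal{A}_K=\mathcal{A}_{\mathbf{0}+K}$ and $\Omega_K=\Omega_{\mathbf{0}+K}$, \[ f(K)\le c_d\operatorname{disc}(\mathcal{A}_K)\le c_dC_d\sqrt{\log(1+|\Omega_K|)}\cdot f(K). \]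
   Context: For $\mathbf{a},\mathbf{b}\in\mathbb{Z}^d$ and a positive integer $\ell$, $\mathrm{AP}_d(\mathbf{a},\mathbf{b},\ell)=\{\mathbf{a}+i\mathbf{b}: i=0,\ldots,\ell-1\}$; the family of arithmetic progressions in a finite set $\Omega\subseteq\mathbb{Z}^d$ consists of all sets $\Omega\cap\mathrm{AP}_d(\mathbf{a},\mathbf{b},\ell)$. For a set system $(\Omega,\mathcal{S})$, $\operatorname{disc}(\mathcal{S})=\min_{\chi:\Omega\to\{-1,1\}}\max_{S\in\mathcal{S}}|\sum_{\omega\in S}\chi(\omega)|$. $K-K=\{\mathbf{x}-\mathbf{y}:\mathbf{x},\mathbf{y}\in K\}$, $\zeta_{K-K}(t)=|\mathbb{Z}^d\cap t(K-K)|$ for a scalar $t$, and $f(K)=\sqrt{s^*}$ where $s^*=\inf\{s>0: s\ge\zeta_{K-K}(1/s)\}$. *)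

(* Defs.v *)
From HB Require Import structures.
From mathcomp Require Import all_boot all_order all_algebra.
From mathcomp Require Import finmap.
From mathcomp Require Import all_classical all_reals all_analysis.

Set Implicit Arguments.
Unset Strict Implicit.
Unset Printing Implicit Defensive.

Import Order.TTheory GRing.Theory Num.Theory.
Import numFieldNormedType.Exports.

Local Open Scope classical_set_scope.
Local Open Scope ring_scope.

(* A colouring chi : Omega -> {-1, 1} is a finite function to bool, the
   boolean b standing for the colour (-1) ^+ b. *)
Definition coloring (T : choiceType) (Omega : {fset T}) :=
  {ffun Omega -> bool}.

Definition coloring_sum (T : choiceType) (Omega : {fset T})
    (chi : coloring Omega) (S : {fset T}) : int :=
  \sum_(w : Omega | val w \in S) (-1) ^+ chi w.

Definition coloring_disc (T : choiceType) (Omega : {fset T})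
    (F : {fset {fset T}}) (chi : coloring Omega) : nat :=
  (\max_(S <- F) `|coloring_sum chi S|)%N.

(* The colouring [ffun=> false] only witnesses that there is one: the value
   below is the minimum of coloring_disc F over all the colourings. *)
Definition disc (T : choiceType) (Omega : {fset T}) (F : {fset {fset T}}) :
    nat :=
  coloring_disc F
    [arg min_(chi < ([ffun=> false] : coloring Omega)) coloring_disc F chi]%N.

(* The step b is an arbitrary integer vector, 0 included. *)
Definition AP (d : nat) (a b : 'rV[int]_d) (l : nat) : set 'rV[int]_d :=
  [set a + b *+ i | i in [set i : nat | (i < l)%N]].

Definition AP_family (d : nat) (Omega : {fset 'rV[int]_d}) :
    {fset {fset 'rV[int]_d}} :=
  [fset S in fpowerset Omega |
    `[< exists (a b : 'rV[int]_d) (l : nat),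
          (0 < l)%N /\ [set` S] = ([set` Omega] `&` AP a b l)%classic >]]%fset.

(* The integer points of A, for bounded A: fset_set is fset0 on infinite
   sets. *)
Definition lattice_points (R : realType) (d : nat) (A : set 'rV[R]_d) :
    {fset 'rV[int]_d} :=
  fset_set [set z : 'rV[int]_d | A (map_mx intr z)].

Definition translate (R : realType) (d : nat) (v : 'rV[R]_d)
    (K : set 'rV[R]_d) : set 'rV[R]_d :=
  [set v + x | x in K].

Definition Omega (R : realType) (d : nat) (v : 'rV[R]_d) (K : set 'rV[R]_d) :
    {fset 'rV[int]_d} :=
  lattice_points (translate v K).

Definition disc_AP (R : realType) (d : nat) (v : 'rV[R]_d)
    (K : set 'rV[R]_d) : nat :=
  disc (Omega v K) (AP_family (Omega v K)).

Definition convex_body (R : realType) (d : nat) (K : set 'rV[R]_d) : Prop :=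
  [/\ convex_set K, closed K, bounded_set K & K° !=set0].

Definition difference_body (R : realType) (d : nat) (K : set 'rV[R]_d) :
    set 'rV[R]_d :=
  [set x - y | x in K & y in K].

Definition zeta (R : realType) (d : nat) (L : set 'rV[R]_d) (t : R) : nat :=
  #|` lattice_points [set t *: x | x in L] |%fset.

Definition sstar (R : realType) (d : nat) (K : set 'rV[R]_d) : R :=
  inf [set s : R | 0 < s /\ (zeta (difference_body K) s^-1)%:R <= s].

Definition f_body (R : realType) (d : nat) (K : set 'rV[R]_d) : R :=
  Num.sqrt (sstar K).

(* Main.v *)
Require Import Defs.
From HB Require Import structures.
From mathcomp Require Import all_boot all_order all_algebra.
From mathcomp Require Import finmap fingroup perm.
From mathcomp Require Import all_classical all_reals all_analysis.
From mathcomp Require Import ring lra zify.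
Import Order.TTheory GRing.Theory Num.Theory.
Import numFieldNormedType.Exports.
Local Open Scope classical_set_scope.
Local Open Scope ring_scope.

(** Write [L = K - K] and [s = sstar K].

    Upper bound.  Let [n] be of the order of [s], so that at most [n] integer
    vectors [b] have [n b] in [L].  For any other step, progressions in [Omega]
    have at most [n] points.  For each of the exceptional steps, every line of
    direction [b] in [Omega] is cut into blocks of length [n], and the blocks
    are grouped into superblocks, so that an initial segment of the line is a
    union of few superblocks, few blocks and at most [n] points.  Counting along
    the rays of the integer lattice shows that the points, blocks and
    superblocks, suitably weighted, have total weight [O(n)] at every point.  A
    Gram-Schmidt walk then produces a colouring that is subgaussian with respect
    to these weights, and a union bound over the polynomially many initial
    segments gives the square root of the logarithm.  The walk is
    derandomised: along each direction the exponential potential is affine, so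
    one can move to the boundary of the cube without increasing it.

    Lower bound.  If [v + K] contains [eps L], take the [m > s/2] integer points
    [b_j] of [(2/s) L] and sum the squared discrepancies of the progressions of
    steps [b_j - b_k] and of a length [l] of order [s].  This is a sum over
    pairs of indices of squares of translates of the colouring; the diagonal
    pairs alone give [l m^2 |Omega|].  Only [O(|Omega|)] starting points matter,
    as is seen by sorting integer points modulo a fixed integer.  For general
    [K] a suitable [v] is obtained from an inscribed simplex of nearly maximal
    volume. *)

(** * Exponential estimates for two-point laws *)

(** The mean of [expR (a * X)] for a random sign [X] of mean [x]. *)
Definition tilt {R : realType} (a x : R) : R :=
  ((1 + x) * expR a + (1 - x) * expR (- a)) / 2.

(** Inverting [1 - y <= expR (- y)] bounds [expR y] by [1 / (1 - y)], and
    [(1 + y + 2 * y ^+ 2) * (1 - y)] exceeds 1 by [y ^+ 2 * (1 - 2 * y)]. *)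
Lemma expR_le_quadratic (R : realType) (y : R) :
  y <= 1 / 2 -> expR y <= 1 + y + 2 * y ^+ 2.
Proof.
move=> hy; have h1 := expR_ge1Dx (- y).
have e0 := expR_gt0 y; have : expR y * expR (- y) = 1 by rewrite -expRD subrr expR0.
move=> e1; have : expR y * (1 - y) <= 1 by rewrite -[leRHS]e1 ler_wpM2l // ltW.
have y2 : 0 <= y ^+ 2 * (1 - 2 * y) 
  by apply: mulr_ge0; [exact: sqr_ge0|lra].
have y1 : 0 < 1 - y by lra.
move=> h2; rewrite -(ler_pM2r y1); apply: le_trans h2 _; nra.
Qed.

(** Hoeffding's inequality with a crude constant. Once [expR (m * t)] is divided out, the linear
    terms of the centred law cancel when [t] is small; when it is large, [8 * t ^+ 2] dominates both
    exponents. *)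
Lemma tilt_le (R : realType) (m t : R) : `|m| <= 1 ->
  tilt t m <= expR (m * t + 8 * t ^+ 2).
Proof.
rewrite ler_norml => /andP[m1 m2].
suff : (1 + m) / 2 * expR (t * (1 - m)) + (1 - m) / 2 * expR (- (t * (1 + m)))
    <= expR (8 * t ^+ 2).
  move=> H; rewrite expRD.
  have -> : tilt t m = expR (m * t) * ((1 + m) / 2 * expR (t * (1 - m)) +
      (1 - m) / 2 * expR (- (t * (1 + m)))).
    have -> : expR (t * (1 - m)) = expR t / expR (m * t).
      by rewrite -expRN -expRD; congr expR; ring.
    have -> : expR (- (t * (1 + m))) = expR (- t) / expR (m * t).
      by rewrite -expRN -expRD; congr expR; ring.
    rewrite /tilt; field; exact/lt0r_neq0/expR_gt0.
  by rewrite ler_pM2l // expR_gt0.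
have [t4|t4] := lerP `|t| (1 / 4).
  move: t4; rewrite ler_norml => /andP[t1 t2].
  have e1 : expR (t * (1 - m)) <= 1 + t * (1 - m) + 2 * (t * (1 - m)) ^+ 2.
    by apply: expR_le_quadratic; nra.
  have e2 : expR (- (t * (1 + m))) <=
      1 + - (t * (1 + m)) + 2 * (- (t * (1 + m))) ^+ 2.
    by apply: expR_le_quadratic; nra.
  have e3 := expR_ge1Dx (8 * t ^+ 2); apply: le_trans e3.
  apply: (@le_trans _ _ ((1 + m) / 2 * (1 + t * (1 - m) + 2 * (t * (1 - m)) ^+ 2)
     + (1 - m) / 2 * (1 + - (t * (1 + m)) + 2 * (- (t * (1 + m))) ^+ 2))).
    by apply: lerD; apply: ler_wpM2l => //; lra.
  have : 0 <= t ^+ 2 * m ^+ 2 by apply: mulr_ge0; exact: sqr_ge0.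
  have := sqr_ge0 t; nra.
have t8 : 2 * `|t| <= 8 * t ^+ 2 by rewrite -[t ^+ 2]real_normK ?num_real //; nra.
have t0 := ler_norm t; have t0' := ler_norm (- t); rewrite normrN in t0'.
have -> : expR (8 * t ^+ 2) = (1 + m) / 2 * expR (8 * t ^+ 2) +
   (1 - m) / 2 * expR (8 * t ^+ 2) by field.
have tn := normr_ge0 t.
by apply: lerD; apply: ler_wpM2l; rewrite ?ler_expR; nra.
Qed.

Lemma tilt_gt0 (R : realType) (a x : R) : `|x| <= 1 -> 0 < tilt a x.
Proof.
rewrite ler_norml => /andP[x1 x2].
have ea := expR_gt0 a; have eb := expR_gt0 (- a); rewrite /tilt.
have := mulr_ge0 (_ : 0 <= 1 + x) (ltW ea); have := mulr_ge0 (_ : 0 <= 1 - x) (ltW eb).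
move=> /(_ ltac:(lra)) h1 /(_ ltac:(lra)) h2.
by have [?|?] := lerP x 0; nra.
Qed.

(* The derivative of [ln (tilt a x)] in [a], the mean of the tilted two-point
   law, differs from its value [x] at [a = 0] by at most [4 * |a|]. *)
Lemma tilt_mean_le (R : realType) (a x : R) : `|x| <= 1 ->
  `|((1 + x) * expR a - (1 - x) * expR (- a)) / 2 - x * tilt a x|
    <= 4 * `|a| * tilt a x.
Proof.
wlog a0 : a x / 0 <= a.
  move=> H x1; have [/H->//|a0] := lerP 0 a.
  have := H (- a) (- x) _ _; rewrite !normrN opprK; move=> /(_ ltac:(lra) x1).
  have -> : tilt (- a) (- x) = tilt a x by rewrite /tilt !opprK; field.
  by apply: le_trans; rewrite -normrN opprK le_eqVlt; apply/orP; left; apply/eqP; congr (`| _ |); field.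
rewrite ler_norml (ger0_norm a0) => /andP[x1 x2].
have ea := expR_gt0 a; have eb := expR_gt0 (- a).
have e1 : expR a * expR (- a) = 1 by rewrite -expRD subrr expR0.
have e2 : expR (- a) <= expR a by rewrite ler_expR; lra.
have e3 : expR a - expR (- a) <= 2 * a * expR a.
  have := expR_ge1Dx (- (2 * a)); have -> : - (2 * a) = - a + - a by ring.
  by rewrite expRD; nra.
have x3 : 0 <= (1 - x) * (1 + x) by apply: mulr_ge0; lra.
rewrite /tilt ger0_norm; last first.
  have -> : ((1 + x) * expR a - (1 - x) * expR (- a)) / 2 -
    x * (((1 + x) * expR a + (1 - x) * expR (- a)) / 2) =
    (1 - x) * (1 + x) * (expR a - expR (- a)) / 2 by field.
  by apply: mulr_ge0; [apply: mulr_ge0|]; lra.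
have h1 : 0 <= a * (1 - x) * expR (- a) by rewrite !mulr_ge0 //; lra.
have h2 : (1 - x) * (1 + x) * (expR a - expR (- a)) <= (1 - x) * (1 + x) * (2 * a * expR a).
  exact: ler_wpM2l.
have h3 : 0 <= a * (1 + x) * expR a * (1 + x) by rewrite !mulr_ge0 //; lra.
nra.
Qed.

(** A further tilt by [b] acts on the law already tilted by [a], whose mean is [m]. [tilt_le]
    controls that factor, and [tilt_mean_le] keeps [m] close to [x]. *)
Lemma tiltD_le (R : realType) (a b x : R) : `|x| <= 1 ->
  expR (- ((a + b) * x)) * tilt (a + b) x <=
  expR (- (a * x)) * tilt a x * expR (4 * `|a| * `|b| + 8 * b ^+ 2).
Proof.
move=> x1; have t0 := @tilt_gt0 _ a x x1.
have ea := expR_gt0 a; have eb := expR_gt0 (- a).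
set m := ((1 + x) * expR a - (1 - x) * expR (- a)) / 2 / tilt a x.
have mE : m * tilt a x = ((1 + x) * expR a - (1 - x) * expR (- a)) / 2.
  by rewrite /m divfK // lt0r_neq0.
have mx : `|m - x| <= 4 * `|a|.
  rewrite -(ler_pM2r t0) -{1}(gtr0_norm t0) -normrM mulrBl mE.
  exact: tilt_mean_le.
have m1 : `|m| <= 1.
  move: x1; rewrite !ler_norml => /andP[x1 x2].
  rewrite /m ler_pdivlMr // ler_pdivrMr //.
  have p1 : 0 <= (1 + x) * expR a by apply: mulr_ge0; lra.
  have p2 : 0 <= (1 - x) * expR (- a) by apply: mulr_ge0; lra.
  by rewrite /tilt; apply/andP; split; lra.
have -> : tilt (a + b) x = tilt a x * tilt b m.
  rewrite {1}/tilt opprD !expRD.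
  have -> : (1 + x) * (expR a * expR b) = (1 + m) * tilt a x * expR b.
    by rewrite [(1 + m) * _]mulrDl mE /tilt; field.
  have -> : (1 - x) * (expR (- a) * expR (- b)) = (1 - m) * tilt a x * expR (- b).
    by rewrite [(1 - m) * _]mulrBl mE /tilt; field.
  by rewrite /tilt; field.
have -> : - ((a + b) * x) = - (a * x) + - (b * x) by ring.
rewrite expRD.
have -> : expR (- (a * x)) * expR (- (b * x)) * (tilt a x * tilt b m) =
  expR (- (a * x)) * tilt a x * (expR (- (b * x)) * tilt b m) by ring.
apply: ler_wpM2l; first by rewrite mulr_ge0 ?expR_ge0 // ltW.
apply: (@le_trans _ _ (expR (- (b * x)) * expR (m * b + 8 * b ^+ 2))).
  by rewrite ler_pM2l ?expR_gt0 //; apply: tilt_le.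
rewrite -expRD ler_expR addrA lerD2r.
have -> : - (b * x) + m * b = (m - x) * b by ring.
apply: le_trans (ler_norm _) _; rewrite normrM ler_wpM2r //.
Qed.

(** * Orthogonal projections *)

Definition dot {R : realType} {m : nat} (u v : 'rV[R]_m) : R :=
  \sum_k u 0 k * v 0 k.

Section Dot.
Context {R : realType} {m : nat}.
Implicit Types (u v w : 'rV[R]_m) (S T : 'M[R]_m).

Lemma dotE u v : dot u v = (u *m v^T) 0 0.
Proof. by rewrite mxE; apply: eq_bigr => k _; rewrite mxE. Qed.

Lemma dotC u v : dot u v = dot v u.
Proof. by apply: eq_bigr => k _; rewrite mulrC. Qed.

Lemma dotDl u v w : dot (u + v) w = dot u w + dot v w.
Proof. by rewrite -big_split; apply: eq_bigr => k _; rewrite mxE mulrDl. Qed.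

Lemma dotDr u v w : dot w (u + v) = dot w u + dot w v.
Proof. by rewrite dotC dotDl !(dotC w). Qed.

Lemma dotZl a u w : dot (a *: u) w = a * dot u w.
Proof. by rewrite mulr_sumr; apply: eq_bigr => k _; rewrite mxE mulrA. Qed.

Lemma dotZr a u w : dot w (a *: u) = a * dot w u.
Proof. by rewrite dotC dotZl dotC. Qed.

Lemma dotNl u w : dot (- u) w = - dot u w.
Proof. by rewrite -scaleN1r dotZl mulN1r. Qed.

Lemma dotNr u w : dot w (- u) = - dot w u.
Proof. by rewrite dotC dotNl dotC. Qed.

Lemma dot0r w : dot w 0 = 0.
Proof. by rewrite -(scale0r (0 : 'rV[R]_m)) dotZr mul0r. Qed.

Lemma dot_ge0 u : 0 <= dot u u.
Proof. by apply: sumr_ge0 => k _; rewrite -expr2 sqr_ge0. Qed.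

Lemma dot_eq0 u : dot u u = 0 -> u = 0.
Proof.
move=> h; apply/rowP => k; rewrite mxE.
have /psumr_eq0P := h => /(_ (fun i _ => sqr_ge0 (u 0 i))) /(_ k isT) /eqP.
by rewrite mulf_eq0 orbb => /eqP.
Qed.

Lemma dot_CS u v : dot u v ^+ 2 <= dot u u * dot v v.
Proof.
have [v0|v0] := eqVneq (dot v v) 0.
  by rewrite (dot_eq0 _ v0) !dot0r expr0n mulr0.
have vp : 0 < dot v v by rewrite lt_def v0 dot_ge0.
have := dot_ge0 (dot v v *: u - dot u v *: v).
rewrite !(dotDl, dotDr, dotNl, dotNr, dotZl, dotZr) (dotC v u) => h.
have : 0 <= dot v v * (dot u u * dot v v - dot u v ^+ 2) by nra.
by rewrite pmulr_rge0 // subr_ge0.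
Qed.

Lemma dotDD u v : dot (u + v) (u + v) = dot u u + 2 * dot u v + dot v v.
Proof. by rewrite dotDl !dotDr (dotC v u); ring. Qed.

(** [kermx S^T] is the orthogonal complement of the row space of [S]. *)
Definition oproj S u : 'rV[R]_m := u *m proj_mx S (kermx S^T).

Lemma proj_sub S u : (oproj S u <= S)%MS.
Proof. exact: proj_mx_sub. Qed.

Lemma capmx_kermx_tr S : (S :&: kermx S^T = 0)%MS.
Proof.
apply/eqP/rowV0P => w; rewrite sub_capmx => /andP[/submxP[D wD] /sub_kermxP wk].
by apply: dot_eq0; rewrite dotE {2}wD trmx_mul mulmxA wk mul0mx mxE.
Qed.

Lemma dot_proj S u w : (w <= S)%MS -> dot (u - oproj S u) w = 0.
Proof.
move=> /submxP[D ->].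
have full : (u <= S + kermx S^T)%MS.
  apply: submx_full; rewrite /row_full mxrank_disjoint_sum ?capmx_kermx_tr //.
  by rewrite mxrank_ker mxrank_tr subnKC // rank_leq_row.
have {1}<- := add_proj_mx (capmx_kermx_tr S) full.
rewrite /oproj addrAC subrr add0r.
have /sub_kermxP h := proj_mx_sub (kermx S^T) S u.
by rewrite dotE trmx_mul mulmxA h mul0mx mxE.
Qed.

Lemma proj_pythagoras S T u : (S <= T)%MS ->
  dot (oproj T u) (oproj T u) =
  dot (oproj S u) (oproj S u) + dot (oproj T u - oproj S u) (oproj T u - oproj S u).
Proof.
move=> ST.
have := dot_proj T u (oproj S u) (submx_trans (proj_sub S u) ST).
have := dot_proj S u (oproj S u) (proj_sub S u).
rewrite !(dotDl, dotDr, dotNl, dotNr) (dotC (oproj S u) (oproj T u)); lra.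
Qed.

Lemma dot_sub_proj_le S u : dot (u - oproj S u) (u - oproj S u) <= dot u u.
Proof.
have := dot_proj S u (oproj S u) (proj_sub S u); have := dot_ge0 (oproj S u).
rewrite !(dotDl, dotDr, dotNl, dotNr) (dotC (oproj S u) u); lra.
Qed.

Lemma dot_proj_le S u : dot (oproj S u) (oproj S u) <= dot u u.
Proof.
have := dot_proj S u (oproj S u) (proj_sub S u); have := dot_ge0 (u - oproj S u).
rewrite !(dotDl, dotDr, dotNl, dotNr) (dotC (oproj S u) u); lra.
Qed.

(* Enlarging the orthogonal complement from that of [T] to that of [S]
   lengthens the residual of [v]; the pairing with [u] moves by at most the
   geometric mean of the two squared lengths involved. *)
Lemma residual_change S T u v : (S <= T)%MS ->
  (dot u (v - oproj S v) - dot u (v - oproj T v)) ^+ 2 <=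
  (dot (oproj T u) (oproj T u) - dot (oproj S u) (oproj S u)) *
  (dot (v - oproj S v) (v - oproj S v) - dot (v - oproj T v) (v - oproj T v)).
Proof.
move=> ST; set D := oproj T v - oproj S v.
have DT : (D <= T)%MS.
  apply: addmx_sub; first exact: proj_sub.
  by rewrite eqmx_opp (submx_trans (proj_sub S v) ST).
have -> : dot u (v - oproj S v) - dot u (v - oproj T v) = dot u D.
  by rewrite /D !(dotDr, dotNr); ring.
have -> : dot u D = dot (oproj T u - oproj S u) D.
  have h1 := dot_proj T u D DT.
  have h2 := dot_proj T v (oproj S u) (submx_trans (proj_sub S u) ST).
  have h3 := dot_proj S v (oproj S u) (proj_sub S u).
  have : dot (oproj S u) D = 0.
    by rewrite dotC; move: h2 h3; rewrite /D !(dotDl, dotNl); lra.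
  by move: h1; rewrite !(dotDl, dotNl); lra.
have -> : dot (v - oproj S v) (v - oproj S v) - dot (v - oproj T v) (v - oproj T v)
    = dot D D.
  have := dot_proj T v D DT; rewrite (_ : v - oproj S v = (v - oproj T v) + D).
    by rewrite dotDD => ->; ring.
  by rewrite /D addrA subrK.
rewrite (proj_pythagoras _ _ u ST) addrAC subrr add0r; exact: dot_CS.
Qed.

End Dot.

(** * The Gram-Schmidt walk *)

(** Move until the first wall is hit. Coordinates already on a wall stand still, so the one that
    stops the motion was interior. *)
Lemma cube_exit (R : realType) (I : finType) (x u : I -> R) (p : I) :
  (forall i, `|x i| <= 1) -> (forall i, `|x i| = 1 -> u i = 0) -> u p != 0 ->
  exists t, [/\ 0 <= t, forall i, `|x i + t * u i| <= 1 &
    exists2 i, `|x i| < 1 & `|x i + t * u i| = 1].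
Proof.
move=> x1 xu up.
(* The time at which coordinate [i] reaches the wall it moves towards. *)
pose e i := (1 - Num.sg (u i) * x i) / `|u i|.
case: (Order.TotalTheory.arg_minP (P := fun i => u i != 0) e up) => j uj jmin.
have eE i : u i != 0 -> e i * `|u i| = 1 - Num.sg (u i) * x i.
  by move=> ui; rewrite divfK // normr_eq0.
have sgx i : u i != 0 -> Num.sg (u i) * x i <= 1.
  move=> ui; apply: le_trans (ler_norm _) _.
  by rewrite normrM normr_sg ui mul1r.
have sgu i : u i = Num.sg (u i) * `|u i| by rewrite -numEsg.
have ej0 : 0 <= e j by rewrite divr_ge0 // subr_ge0 sgx.
exists (e j); split=> //.
- move=> i; have [ui|ui] := eqVneq (u i) 0; first by rewrite ui mulr0 addr0.
  have h1 : e j * `|u i| <= 1 - Num.sg (u i) * x i.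
    by rewrite -eE // ler_wpM2r // jmin.
  have h0 : 0 <= e j * `|u i| by rewrite mulr_ge0.
  have := x1 i; rewrite sgu !ler_norml => /andP[l1 l2].
  move: h1 h0; case: sgrP ui => // _ _; rewrite ?mul1r ?mulN1r ?mulrN => h1 h0; lra.
- exists j.
    by rewrite lt_neqAle x1 andbT; apply: contra_neq uj => /xu.
  rewrite sgu mulrCA eE //.
  have := sqr_sg (u j); rewrite uj expr2 => ss.
  by rewrite mulrBr mulrA ss mulr1 mul1r addrCA subrr addr0 normr_sg uj.
Qed.

(** In [pivot_shrink], [e] is the squared length of the residual, [f] its growth, [a] the pairing
    with the residual, [b] its change and [g] the drop of [norm_proj]. Once [g] is replaced by
    [b ^+ 2 / f], the two sides differ by a weighted square plus multiples of [a * b]. If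
    [a * b < 0], the square compensates because [e + f <= 1]. *)
Lemma walk_budget (R : realType) (a b e f g : R) :
  0 <= e -> 0 <= f -> e + f <= 1 -> (e = 0 -> a = 0) -> 0 <= g ->
  b ^+ 2 <= g * f ->
  8 * ((a + b) ^+ 2 * ((e + f)^-1 - 1)) + (4 * `|a| * `|b| + 8 * b ^+ 2) <=
  8 * g + 8 * (a ^+ 2 * (e^-1 - 1)).
Proof.
move=> e0 f0 ef1 ea g0 bgf.
have [fz|fn] := eqVneq f 0.
  have -> : b = 0 by apply/eqP; rewrite -sqrf_eq0 eq_le sqr_ge0 andbT; nra.
  by rewrite fz !addr0 normr0; nra.
have fp : 0 < f by rewrite lt_def fn.
have gb : b ^+ 2 / f <= g by rewrite ler_pdivrMr.
have [ez|en] := eqVneq e 0.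
  rewrite (ea ez) ez !add0r normr0 expr0n /= mul0r mulr0 mulr0 mul0r add0r addr0.
  have -> : 8 * (b ^+ 2 * (f^-1 - 1)) + 8 * b ^+ 2 = 8 * (b ^+ 2 / f) by ring.
  by rewrite ler_pM2l.
have ep : 0 < e by rewrite lt_def en.
suff : 8 * ((a + b) ^+ 2 * ((e + f)^-1 - 1)) + (4 * `|a| * `|b| + 8 * b ^+ 2) <=
  8 * (b ^+ 2 / f) + 8 * (a ^+ 2 * (e^-1 - 1)) by lra.
rewrite -subr_ge0.
have -> : 8 * (b ^+ 2 / f) + 8 * (a ^+ 2 * (e^-1 - 1)) -
  (8 * ((a + b) ^+ 2 * ((e + f)^-1 - 1)) + (4 * `|a| * `|b| + 8 * b ^+ 2)) =
  8 * ((a * f - b * e) ^+ 2 / (e * f * (e + f))) + 16 * (a * b) - 4 * (`|a| * `|b|).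
  by field; do ?split; rewrite ?lt0r_neq0 //; lra.
rewrite -normrM.
have p3 : 0 < e * f * (e + f) by rewrite !mulr_gt0 // addr_gt0.
have q0 : 0 <= (a * f - b * e) ^+ 2 / (e * f * (e + f)) by rewrite divr_ge0 ?sqr_ge0 // ltW.
have [ab|ab] := lerP 0 (a * b); first by rewrite ger0_norm //; lra.
rewrite ltr0_norm //.
suff : - 4 * (a * b) <= (a * f - b * e) ^+ 2 / (e * f * (e + f)) by lra.
rewrite ler_pdivlMr //.
have h1 : - 4 * (a * b) * (e * f) <= (a * f - b * e) ^+ 2.
  have := sqr_ge0 (a * f + b * e); nra.
apply: le_trans h1.
have : 0 <= - (a * b) * (e * f) by rewrite mulr_ge0 // ?oppr_ge0 ltW // mulr_gt0.
move=> h; have -> : - 4 * (a * b) * (e * f * (e + f)) = 4 * (- (a * b) * (e * f)) * (e + f) by ring.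
have -> : - 4 * (a * b) * (e * f) = 4 * (- (a * b) * (e * f)) * 1 by ring.
by apply: ler_wpM2l => //; lra.
Qed.

Lemma ler_pM_budget (R : realType) (p q h h' e : R) :
  0 <= p -> 0 <= h -> h' <= h * e -> p * e <= q -> p * h' <= q * h.
Proof.
move=> p0 h0 hh pq; apply: le_trans (ler_wpM2l p0 hh) _.
by rewrite mulrCA mulrC ler_wpM2r.
Qed.

(** The factors [expR (t * a)] cancel, and [tilt a] is affine in its second argument. *)
Lemma expR_tilt_affine (R : realType) (s c a y t : R) :
  expR (s + t * a + c) * (expR (- (a * (y + t))) * tilt a (y + t)) =
  expR (s + c) * (expR (- (a * y)) * tilt a y) +
  t * (expR (s + c) * (expR (- (a * y)) * ((expR a - expR (- a)) / 2))).
Proof.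
have -> : - (a * (y + t)) = - (a * y) - t * a by ring.
have -> : s + t * a + c = s + c + t * a by ring.
rewrite !(expRD _ (t * a)) (expRD _ (- (t * a))) (expRN (t * a)) /tilt.
field; exact/lt0r_neq0/expR_gt0.
Qed.

Section Walk.
Context {R : realType} {m : nat} {I T : finType}.
Variables (v : I -> 'rV[R]_m) (th : T -> 'rV[R]_m).
Hypothesis v1 : forall i, dot (v i) (v i) <= 1.
Implicit Types (A B : {set I}) (x u : I -> R).

Definition rspan (A : {set I}) : 'M[R]_m := (\sum_(i in A) <<v i>>)%MS.

Lemma rspanS (A B : {set I}) : A \subset B -> (rspan A <= rspan B)%MS.
Proof.
move=> /fintype.subsetP AB; apply/sumsmx_subP => i iA; rewrite (sumsmx_sup i) ?AB //.
Qed.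

Lemma rspan_mem (A : {set I}) i : i \in A -> (v i <= rspan A)%MS.
Proof. by move=> iA; rewrite (sumsmx_sup i) // genmxE. Qed.

Lemma rspanP (A : {set I}) w : (w <= rspan A)%MS ->
  exists2 c : I -> R, (forall i, i \notin A -> c i = 0) & w = \sum_i c i *: v i.
Proof.
move=> /sub_sumsmxP[u ->].
have /choice [c cE] i : exists c, u i *m <<v i>>%MS = c *: v i.
  by apply/sub_rVP; rewrite -(genmxE (v i)) submxMl.
exists (fun i => if i \in A then c i else 0) => [i /negbTE->//|].
rewrite [RHS](bigID (mem A)) /= [X in _ = _ + X]big1 ?addr0.
  by apply: eq_bigr => i iA; rewrite iA cE.
by move=> i /negbTE->; rewrite scale0r.
Qed.

Definition alive (x : I -> R) : {set I} := [set i | `|x i| < 1].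
Definition vsum (x : I -> R) : 'rV[R]_m := \sum_i x i *: v i.
Definition residual (A : {set I}) p := v p - oproj (rspan (A :\ p)) (v p).
Definition norm_proj (A : {set I}) k :=
  dot (oproj (rspan A) (th k)) (oproj (rspan A) (th k)).

(** The potential between two pivots: the term in [norm_proj] pays for whatever the alive vectors
    can still contribute. *)
Definition idle_potential (x : I -> R) (k : T) : R :=
  expR (dot (th k) (vsum x) + 8 * norm_proj (alive x) k).

(* Along the walk direction only the last factor and the first summand move, and
   their product is affine; the summand in [a ^+ 2] is the budget left for the
   residual of the pivot to grow up to length 1. *)
Definition pivot_potential (x : I -> R) (A : {set I}) (p : I) (k : T) : R :=
  let r := residual A p in let a := dot (th k) r in
  expR (dot (th k) (vsum x) + (8 * norm_proj (A :\ p) k +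
    8 * (a ^+ 2 * ((dot r r)^-1 - 1)))) * (expR (- (a * x p)) * tilt a (x p)).

Definition rounds (x : I -> R) (w : T -> R) :=
  exists z : I -> bool, \sum_k expR (dot (th k) (vsum (fun i => (-1) ^+ z i))) <=
    \sum_k w k.

Lemma residual_le1 A p : dot (residual A p) (residual A p) <= 1.
Proof. exact: le_trans (dot_sub_proj_le _ _) (v1 p). Qed.

Lemma vsumD x u : vsum (fun i => x i + u i) = vsum x + vsum u.
Proof. by rewrite /vsum -big_split; apply: eq_bigr => i _; rewrite scalerDl. Qed.

Lemma vsumZ a x : vsum (fun i => a * x i) = a *: vsum x.
Proof. by rewrite /vsum scaler_sumr; apply: eq_bigr => i _; rewrite scalerA. Qed.

(** The projection removed from [v p] is a combination of the other vectors indexed by [A]; its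
    coefficients give a move of the colouring that fixes every coordinate outside [A]. *)
Lemma residual_dir A p : exists u, [/\ u p = 1,
  forall i, i \notin A -> i != p -> u i = 0 & vsum u = residual A p].
Proof.
have [c c0 cE] := rspanP _ _ (proj_sub (rspan (A :\ p)) (v p)).
exists (fun i => (i == p)%:R + - 1 * c i); split.
- by rewrite eqxx c0 ?mulr0 ?addr0 // !inE eqxx.
- by move=> i iA /negbTE ip; rewrite ip c0 ?mulr0 ?addr0 // !inE ip.
rewrite vsumD vsumZ /residual cE -/(vsum c) scaleN1r; congr (_ - _).
rewrite /vsum (bigD1 p) //= eqxx scale1r big1 ?addr0 // => i /negbTE->.
by rewrite scale0r.
Qed.

(** [v p] lies in the span of the alive vectors, so dropping it lowers [norm_proj] by at least
    [a ^+ 2 / dot r r]. This pays for the new budget term and for the [8 * a ^+ 2] coming from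
    [tilt_le]. *)
Lemma pivot_start x p k : p \in alive x ->
  pivot_potential x (alive x) p k <= idle_potential x k.
Proof.
move=> pA; rewrite /pivot_potential /idle_potential.
set r := residual _ _; set a := dot _ r; set A := alive x in pA *.
have xp : `|x p| <= 1 by move: pA; rewrite inE => /ltW.
have SA : (rspan (A :\ p) <= rspan A)%MS by apply/rspanS/finset.subD1set.
set N := norm_proj (A :\ p) k.
have h : a ^+ 2 * (dot r r)^-1 <= norm_proj A k - N.
  have := residual_change _ _ (th k) (v p) SA.
  have -> : v p - oproj (rspan A) (v p) = 0.
    apply: dot_eq0.
    have := dot_proj (rspan A) (v p) (v p) (rspan_mem _ _ pA).
    have := dot_proj (rspan A) (v p) (oproj (rspan A) (v p)) (proj_sub _ _).
    rewrite [in X in _ -> _ -> X]dotDr dotNr; lra.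
  rewrite !dot0r !subr0 -/r -/a => h.
  (* For a zero residual the quotient is 0, since [0^-1 = 0]. *)
  have [r0|r0] := eqVneq (dot r r) 0.
    rewrite r0 invr0 mulr0 subr_ge0 /norm_proj (proj_pythagoras _ _ _ SA).
    by rewrite lerDl dot_ge0.
  by rewrite ler_pdivrMr // lt_def r0 dot_ge0.
have t1 := tilt_le _ (x p) a xp.
apply: (@le_trans _ _ (expR (dot (th k) (vsum x) + (8 * N + 8 * (a ^+ 2 * ((dot r r)^-1 - 1))))
   * (expR (- (a * x p)) * expR (x p * a + 8 * a ^+ 2)))).
  by rewrite ler_pM2l ?expR_gt0 // ler_pM2l ?expR_gt0.
rewrite -!expRD ler_expR; move: h; set q := (dot r r)^-1; lra.
Qed.

(** At a sign the two-point law is deterministic and the last factor is 1; the unspent budget is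
    nonnegative because residuals have length at most 1. *)
Lemma pivot_dead x A p k : alive x \subset A :\ p -> `|x p| = 1 ->
  idle_potential x k <= pivot_potential x A p k.
Proof.
move=> AA xp; rewrite /pivot_potential /idle_potential.
have r1 := residual_le1 A p.
set r := residual _ _ in r1 *; set a := dot _ r.
have -> : expR (- (a * x p)) * tilt a (x p) = 1.
  have e1 : expR a * expR (- a) = 1 by rewrite -expRD subrr expR0.
  have : (x p == 1) || (x p == -1).
    by have := eqr_norml (x p) 1; rewrite xp eqxx ler01 andbT => <-.
  move=> /orP[] /eqP xp1.
  - by rewrite xp1 /tilt subrr mul0r addr0 mulr1 mulrC -[RHS]e1; field.
  - by rewrite xp1 /tilt subrr mul0r add0r mulrN mulr1 opprK -[RHS]e1; field.
rewrite mulr1 ler_expR lerD2l.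
have h : norm_proj (alive x) k <= norm_proj (A :\ p) k.
  by rewrite /norm_proj (proj_pythagoras _ _ _ (rspanS _ _ AA)) lerDl dot_ge0.
have [r0|r0] := eqVneq (dot r r) 0.
  have : a = 0 by rewrite /a (dot_eq0 _ r0) dot0r.
  move=> ->; rewrite expr0n mul0r; lra.
have : 0 <= a ^+ 2 * ((dot r r)^-1 - 1).
  rewrite mulr_ge0 ?sqr_ge0 // subr_ge0 invr_ge1 ?unitfE //.
  by rewrite lt_def r0 dot_ge0.
lra.
Qed.

(** When other coordinates freeze, the residual of the pivot grows. [tiltD_le] gives the price of
    this change, and [walk_budget] shows that the drop of [norm_proj] and the reserved budget cover
    it. *)
Lemma pivot_shrink x (A B : {set I}) p k : `|x p| <= 1 -> B \subset A ->
  pivot_potential x B p k <= pivot_potential x A p k.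
Proof.
move=> xp BA; rewrite /pivot_potential.
have r1 := residual_le1 B p.
have ST : (rspan (B :\ p) <= rspan (A :\ p))%MS by apply/rspanS/finset.setSD.
have h := residual_change _ _ (th k) (v p) ST.
rewrite -!/(residual _ _) in h.
rewrite -[dot (oproj (rspan (A :\ p)) _) _]/(norm_proj (A :\ p) k) in h.
rewrite -[dot (oproj (rspan (B :\ p)) _) _]/(norm_proj (B :\ p) k) in h.
have rr : dot (residual A p) (residual A p) <= dot (residual B p) (residual B p).
  rewrite -subr_ge0.
  have := proj_pythagoras _ _ (v p) ST.
  have h1 := dot_proj (rspan (B :\ p)) (v p) _ (proj_sub _ (v p)).
  have h2 := dot_proj (rspan (A :\ p)) (v p) _ (proj_sub _ (v p)).
  have := dot_ge0 (oproj (rspan (A :\ p)) (v p) - oproj (rspan (B :\ p)) (v p)).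
  move: h1 h2; rewrite /residual !(dotDl, dotDr, dotNl, dotNr).
  rewrite (dotC (oproj (rspan (A :\ p)) (v p)) (v p)).
  rewrite (dotC (oproj (rspan (B :\ p)) (v p)) (v p)).
  move: (dot _ _) (dot _ _) (dot _ _) (dot _ _) (dot _ _) (dot _ _) (dot _ _) => *; lra.
set r' := residual B p in r1 h rr *; set r := residual A p in h rr *.
set a' := dot (th k) r' in h *; set a := dot (th k) r in h *.
have g0 : 0 <= norm_proj (A :\ p) k - norm_proj (B :\ p) k.
  by rewrite subr_ge0 /norm_proj (proj_pythagoras _ _ _ ST) lerDl dot_ge0.
have ea : dot r r = 0 -> a = 0 by move=> /dot_eq0 rz; rewrite /a rz dot0r.
have f0 : 0 <= dot r' r' - dot r r by rewrite subr_ge0.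
have ef : dot r r + (dot r' r' - dot r r) <= 1 by rewrite addrC subrK.
have := walk_budget _ a (a' - a) _ _ _ (dot_ge0 r) f0 ef ea g0 h.
have -> : a + (a' - a) = a' by ring.
have -> : dot r r + (dot r' r' - dot r r) = dot r' r' by ring.
move=> hb.
have := tiltD_le _ a (a' - a) _ xp; have -> : a + (a' - a) = a' by ring.
move=> ht.
apply: ler_pM_budget ht _; rewrite ?expR_ge0 //.
  by rewrite mulr_ge0 ?expR_ge0 // ltW // tilt_gt0.
rewrite -expRD ler_expR; move: hb.
move: (dot r r)^-1 (dot r' r')^-1 (norm_proj (B :\ p) k) (norm_proj (A :\ p) k).
move: (dot (th k) (vsum x)) ((a' - a) ^+ 2) `|a' - a| `|a| (a ^+ 2) (a' ^+ 2).
move=> *; lra.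
Qed.

Lemma pivot_affine x u A p k t : u p = 1 -> vsum u = residual A p ->
  pivot_potential (fun i => x i + t * u i) A p k = pivot_potential x A p k +
  t * (expR (dot (th k) (vsum x) + (8 * norm_proj (A :\ p) k +
    8 * (dot (th k) (residual A p) ^+ 2 *
      ((dot (residual A p) (residual A p))^-1 - 1)))) *
   (expR (- (dot (th k) (residual A p) * x p)) *
   ((expR (dot (th k) (residual A p)) - expR (- dot (th k) (residual A p))) / 2))).
Proof.
move=> up uE; rewrite /pivot_potential vsumD vsumZ uE up mulr1 dotDr dotZr.
exact: expR_tilt_affine.
Qed.

(** Induction on the number of alive coordinates. Both claims are carried together because a pivot
    is kept until it freezes, and only then is a new one chosen. *)
Lemma walk n x : (forall i, `|x i| <= 1) -> (#|alive x| <= n)%N ->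
  rounds x (idle_potential x) /\
  forall p, p \in alive x -> rounds x (pivot_potential x (alive x) p).
Proof.
elim: n x => [|n IH] x x1 xn; last first.
  have claim p : p \in alive x -> rounds x (pivot_potential x (alive x) p).
    move=> pA; have [u [up u0 uE]] := residual_dir (alive x) p.
    (* The slope in [t] of the potential of [k], as computed in [pivot_affine]. *)
    pose b k := (expR (dot (th k) (vsum x) + (8 * norm_proj (alive x :\ p) k +
    8 * (dot (th k) (residual (alive x) p) ^+ 2 *
      ((dot (residual (alive x) p) (residual (alive x) p))^-1 - 1)))) *
     (expR (- (dot (th k) (residual (alive x) p) * x p)) *
     ((expR (dot (th k) (residual (alive x) p)) -
       expR (- dot (th k) (residual (alive x) p))) / 2))).
    (* Of the two orientations of [u], the one along which the total potential does not increase is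
       followed to the boundary. *)
    have [t [tb tx [j xj tj]]] : exists t, [/\ t * (\sum_k b k) <= 0,
        forall i, `|x i + t * u i| <= 1 &
        exists2 i, `|x i| < 1 & `|x i + t * u i| = 1].
      have ux i : `|x i| = 1 -> u i = 0.
        move=> xi; apply: u0; first by rewrite inE xi ltxx.
        by apply: contraTneq pA => <-; rewrite inE xi ltxx.
      have up0 : u p != 0 by rewrite up oner_eq0.
      have [b0|b0] := lerP (\sum_k b k) 0.
        have [t [t0 h1 h2]] := cube_exit _ _ _ _ _ x1 ux up0.
        by exists t; split=> //; rewrite mulr_ge0_le0.
      have ux' i : `|x i| = 1 -> - u i = 0 by move=> /ux->; rewrite oppr0.
      have up' : - u p != 0 by rewrite oppr_eq0.
      have [t [t0 h1 [i h2 h3]]] := cube_exit _ _ x (fun i => - u i) p x1 ux' up'.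
      exists (- t); split; first by rewrite mulr_le0_ge0 ?oppr_le0 // ltW.
        by move=> l; have := h1 l; rewrite mulrN mulNr.
      by exists i => //; move: h3; rewrite mulrN mulNr.
    pose y i := x i + t * u i.
    have yA : alive y \proper alive x.
      apply/fintype.properP; split; last first.
        by exists j; rewrite !inE ?xj // /y tj ltxx.
      apply/fintype.subsetP => i; apply: contraLR => iA; rewrite inE /y.
      move: (iA); rewrite inE lt_neqAle x1 andbT negbK => /eqP xi.
      rewrite u0 // ?mulr0 ?addr0 ?xi ?ltxx //.
      by apply: contraTneq pA => <-.
    have yn : (#|alive y| <= n)%N by rewrite -ltnS (leq_trans (proper_card yA)).
    have [idle pivot] := IH y tx yn.
    have desc : \sum_k pivot_potential y (alive x) p k <=
        \sum_k pivot_potential x (alive x) p k.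
      rewrite (eq_bigr _ (fun k _ => pivot_affine x u (alive x) p k t up uE)).
      by rewrite big_split /= -mulr_sumr gerDl.
    have [py|py] := boolP (p \in alive y).
      have [z zle] := pivot p py; exists z; apply: le_trans zle (le_trans _ desc).
      by apply: ler_sum => k _; apply: pivot_shrink (tx p) (proper_sub yA).
    have [z zle] := idle; exists z; apply: le_trans zle (le_trans _ desc).
    apply: ler_sum => k _; apply: pivot_dead.
      by rewrite finset.subsetD1 (proper_sub yA).
    by apply/eqP; move: py; rewrite inE lt_neqAle tx andbT negbK.
  split=> //; have [p pA|A0] := pickP (mem (alive x)).
    have [z zle] := claim p pA; exists z; apply: le_trans zle _.
    by apply: ler_sum => k _; exact: pivot_start.
  by apply IH => //; rewrite eq_card0.
(* No coordinate is alive: [x] is itself a sign vector. *)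
have A0 : alive x = finset.set0 by apply/eqP; rewrite -cards_eq0 -leqn0.
split; last by rewrite A0 => p; rewrite inE.
exists (fun i => x i != 1); apply: ler_sum => k _; rewrite ler_expR.
have -> : vsum (fun i => (-1) ^+ (x i != 1)) = vsum x.
  congr vsum; apply: funext => i.
  have : i \notin alive x by rewrite A0 inE.
  rewrite inE lt_neqAle x1 andbT negbK eqr_norml ler01 andbT.
  by case: eqP => [->//|_ /eqP->]; rewrite expr1.
by rewrite lerDl mulr_ge0 // dot_ge0.
Qed.

End Walk.

Theorem gram_schmidt_walk (R : realType) (m : nat) (I T : finType)
    (v : I -> 'rV[R]_m) (th : T -> 'rV[R]_m) :
  (forall i, dot (v i) (v i) <= 1) ->
  exists z : I -> bool,
    \sum_k expR (dot (th k) (\sum_i (-1) ^+ z i *: v i)) <=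
    \sum_k expR (8 * dot (th k) (th k)).
Proof.
move=> v1; have z1 i : `|(fun=> 0 : R) (i : I)| <= 1 by rewrite normr0.
have [[z zle] _] := walk v th v1 _ (fun=> 0) z1 (leqnn _).
exists z; apply: le_trans zle _; apply: ler_sum => k _; rewrite ler_expR.
rewrite /vsum big1 ?dot0r ?add0r; last by move=> i _; rewrite scale0r.
by rewrite ler_pM2l // dot_proj_le.
Qed.

(** * Weighted decompositions and lattice rays *)

(** Each point becomes the vector of its atoms scaled by the square root of [w j / s], of length at
    most 1; each test gets the inverse scaling, so that pairings are unchanged and its squared
    length is at most [s * t]. *)
Lemma decomposition_discrepancy (R : realType) (I J Q : finType)
    (E : J -> pred I) (w : J -> R) (c : Q -> J -> R) (s t l : R) :
  (forall j, 0 < w j) -> 0 < s -> 0 < t -> 0 < l ->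
  (forall i, \sum_(j | E j i) w j <= s) ->
  (forall q, \sum_j c q j ^+ 2 / w j <= t) ->
  2 * #|Q|%:R <= expR l ->
  exists z : I -> bool, forall q,
    `|\sum_i (-1) ^+ z i * \sum_(j | E j i) c q j| <= 2 * Num.sqrt (8 * (s * t) * l).
Proof.
move=> w0 s0 t0 l0 Es ct Ql.
pose va i j := (E j i)%:R * Num.sqrt (w j / s).
pose ua q j := c q j * Num.sqrt (s / w j).
pose v i := \row_(k < #|J|) va i (enum_val k).
pose u q := \row_(k < #|J|) ua q (enum_val k).
have dotJ (a b : J -> R) : dot (\row_(k < #|J|) a (enum_val k)) (\row_(k < #|J|) b (enum_val k)) =
    \sum_j a j * b j.
  rewrite /dot (reindex_onto (@enum_rank J) (@enum_val J predT)) /=; last by move=> k _; rewrite enum_valK.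
  rewrite [LHS](eq_bigl predT) => [|j]; last by rewrite enum_rankK eqxx.
  by apply: eq_bigr => k _; rewrite !mxE !enum_rankK.
have v1 i : dot (v i) (v i) <= 1.
  rewrite (dotJ (va i) (va i)) -(@ler_pM2r _ s) // mul1r; apply: le_trans (Es i).
  rewrite mulr_suml [leRHS]big_mkcond; apply: ler_sum => j _; rewrite /va.
  case: (E j i); last by rewrite !mul0r.
  by rewrite !mul1r -expr2 sqr_sqrtr ?divfK ?gt_eqF // divr_ge0 // ltW.
have u1 q : dot (u q) (u q) <= s * t.
  rewrite (dotJ (ua q) (ua q)) -ler_pdivrMl //; apply: le_trans (ct q).
  rewrite mulr_sumr; apply: ler_sum => j _.
  rewrite /ua -expr2 exprMn sqr_sqrtr; last by rewrite divr_ge0 // ltW.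
  by rewrite le_eqVlt; apply/orP; left; apply/eqP; field; rewrite !gt_eqF.
(* Chosen so that each exponent on the right of the walk is at most [l]; with [2 * #|Q|] tests the
   total is at most [expR (2 * l)]. *)
pose x := Num.sqrt (l / (8 * (s * t))).
have st : 0 < 8 * (s * t) by rewrite !mulr_gt0.
have x0 : 0 < x by rewrite sqrtr_gt0 divr_gt0.
have x2 : x ^+ 2 * (8 * (s * t)) = l.
  by rewrite sqr_sqrtr ?divfK ?gt_eqF // divr_ge0 // ltW.
(* Every test enters with both signs, to bound the absolute value. *)
have [z zle] := gram_schmidt_walk R _ _ _ v
  (fun p : Q * bool => ((-1) ^+ p.2 * x) *: u p.1) v1.
have {}zle : \sum_(p : Q * bool)
   expR (dot (((-1) ^+ p.2 * x) *: u p.1) (\sum_i (-1) ^+ z i *: v i))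
   <= expR (2 * l).
  apply: le_trans zle _; rewrite [2 * l]mulr_natl mulr2n expRD.
  apply: (@le_trans _ _ (\sum_(p : Q * bool) expR l)).
    apply: ler_sum => p _; rewrite ler_expR dotZl dotZr.
    rewrite [_ * x * _]mulrA -expr2 exprMn sqrr_sign mul1r.
    rewrite -x2 mulrCA ler_pM2l ?exprn_gt0 // ler_pM2l //.
  rewrite sumr_const card_prod card_bool -[leLHS]mulr_natl ler_wpM2r ?expR_ge0 //.
  by rewrite natrM mulrC.
exists z => q.
have uE : dot (u q) (\sum_i (-1) ^+ z i *: v i) =
    \sum_i (-1) ^+ z i * \sum_(j | E j i) c q j.
  rewrite /dot; under eq_bigr do rewrite summxE mulr_sumr.
  rewrite exchange_big; apply: eq_bigr => i _.
  transitivity ((-1) ^+ z i * dot (u q) (v i)).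
    by rewrite /dot mulr_sumr; apply: eq_bigr => k _; rewrite !mxE mulrCA.
  rewrite (dotJ (ua q) (va i)) [in RHS]big_mkcond; congr (_ * _).
  apply: eq_bigr => j _; rewrite /ua /va.
  case: (E j i); last by rewrite mul0r mulr0.
  rewrite mul1r -mulrA -sqrtrM ?divr_ge0 ?ltW //.
  rewrite [X in Num.sqrt X](_ : _ = 1) ?sqrtr1 ?mulr1 //.
  by field; rewrite !gt_eqF.
set X := \sum_i _ * \sum_(j | _) _ in uE *.
have bound (b : bool) : (-1) ^+ b * x * X <= 2 * l.
  rewrite -ler_expR; apply: le_trans zle; rewrite (bigD1 (q, b)) //= dotZl uE.
  by rewrite lerDl sumr_ge0 // => p _; exact: expR_ge0.
have sq : Num.sqrt (8 * (s * t) * l) * x = l.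
  rewrite -sqrtrM; last by rewrite mulr_ge0 // ltW.
  rewrite [X in Num.sqrt X](_ : _ = l ^+ 2) ?sqrtr_sqr ?gtr0_norm //.
  by field; rewrite !gt_eqF.
rewrite -(ler_pM2r x0) -[2 * _ * x]mulrA sq.
have := bound true; have := bound false; rewrite expr0 expr1 mul1r !mulN1r mulNr.
by case: (ger0P X) => X0; lra.
Qed.

Definition row_content {d : nat} (b : 'rV[int]_d) : nat := \big[gcdn/0%N]_j absz (b 0%R j).

Definition primitive {d : nat} (b : 'rV[int]_d) : 'rV[int]_d :=
  map_mx (fun z => (z %/ (row_content b)%:Z)%Z) b.

Section Content.
Context {d : nat}.
Implicit Types (b : 'rV[int]_d).

Lemma mulrnE_row b k j : (b *+ k) 0 j = b 0 j *+ k.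
Proof. by rewrite mulmxnE. Qed.

Lemma content_muln b k : row_content (b *+ k) = (k * row_content b)%N.
Proof.
rewrite /row_content (big_morph (muln k) (@muln_gcdr k) (muln0 k)).
by apply: eq_bigr => j _; rewrite mulrnE_row -mulr_natl natz abszM absz_nat.
Qed.

Lemma dvdn_content b j : (row_content b %| absz (b 0%R j))%N.
Proof. exact: (biggcdn_inf j). Qed.

Lemma row_content_gt0 b : b != 0 -> (0 < row_content b)%N.
Proof.
apply: contra_neqT; rewrite lt0n negbK => /eqP c0; apply/rowP => j; rewrite mxE.
by have := dvdn_content b j; rewrite c0 dvd0n absz_eq0 => /eqP.
Qed.

Lemma primitiveK b : primitive b *+ row_content b = b.
Proof.
apply/rowP => j; rewrite mulrnE_row mxE -mulr_natr natz divzK //.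
by rewrite dvdzE dvdn_content.
Qed.

Lemma content_primitive b : b != 0 -> row_content (primitive b) = 1%N.
Proof.
move=> b0; apply/eqP; rewrite -(eqn_pmul2l (row_content_gt0 _ b0)).
by rewrite -content_muln primitiveK muln1.
Qed.

Lemma primitiveMn b k : (0 < k)%N -> primitive (b *+ k) = primitive b.
Proof.
move=> k0; apply/rowP => j; rewrite !mxE content_muln mulrnE_row -mulr_natl natz.
by rewrite PoszM divzMpl.
Qed.

End Content.

(** Telescoping: the new term is at most [2 * (b - a)] for consecutive square roots [a] and [b], as
    [(a - b) ^+ 2 >= 0]. *)
Lemma sum_inv_sqrt_le (R : realType) (x : nat) :
  \sum_(1 <= j < x.+1) (Num.sqrt j%:R)^-1 <= 2 * Num.sqrt x%:R :> R.
Proof.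
elim: x => [|x IH]; first by rewrite big_geq // sqrtr0 mulr0.
rewrite big_nat_recr //=; apply: le_trans (lerD IH (lexx _)) _.
set a := Num.sqrt x%:R; set b := Num.sqrt x.+1%:R.
have b0 : 0 < b by rewrite sqrtr_gt0.
have a0 : 0 <= a by rewrite sqrtr_ge0.
have a2 : a ^+ 2 = x%:R by rewrite sqr_sqrtr.
have b2 : b ^+ 2 = x%:R + 1 by rewrite sqr_sqrtr // natr1.
rewrite -lerBrDr -(ler_pM2r b0) mulrBl mulVf ?gt_eqF //.
have := sqr_ge0 (a - b); nra.
Qed.

(* [k b] counts multiples of [b] in [D]: on the ray spanned by a primitive [p]
   holding [x] points of [D], the point [j p] has at most [x / j] of them. *)
Lemma sum_sqrt_multiples (R : realType) (d : nat) (D : {fset 'rV[int]_d})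
    (k : 'rV[int]_d -> nat) :
  (forall b, b \in D -> b != 0) ->
  (forall b i, b \in D -> (0 < i)%N -> (i <= row_content b * k b)%N ->
     primitive b *+ i \in D) ->
  (forall b, b \in D -> (0 < k b)%N) ->
  \sum_(b <- D) Num.sqrt (k b)%:R <= 2 * (#|` D|%fset)%:R :> R.
Proof.
move=> D0 Dk k0.
have sum1 (s : seq 'rV[int]_d) : \sum_(b <- s) 1 = (size s)%:R :> R.
  by rewrite -sum1_size natr_sum.
rewrite -(sum1 D).
rewrite [leLHS](partition_big_imfset _ primitive).
rewrite [X in _ * X](partition_big_imfset _ primitive) /= mulr_sumr.
rewrite big_seq [leRHS]big_seq; apply: ler_sum => p /imfsetP[/= b0 b0D pE].
rewrite -big_filter -[X in _ <= _ * X]big_filter.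
set r := [seq _ <- _ | _].
have ur : uniq r by rewrite filter_uniq // fset_uniq.
have rP b : b \in r -> b \in D /\ primitive b = p by rewrite mem_filter => /andP[/eqP].
have kx b : b \in r -> (row_content b * k b <= size r)%N.
  move=> /rP[bD bp].
  pose s := [seq p *+ i | i <- iota 1 (row_content b * k b)].
  have us : uniq s.
    rewrite map_inj_in_uniq ?iota_uniq // => i j _ _ /(congr1 row_content).
    by rewrite !content_muln -bp content_primitive ?muln1 // D0.
  have : {subset s <= r}.
    move=> _ /mapP[i + ->]; rewrite mem_iota add1n ltnS => /andP[i0 ik].
    rewrite mem_filter -bp Dk // andbT primitiveMn //.
    have := primitiveMn (primitive b) (row_content b) (row_content_gt0 _ (D0 _ bD)).
    by rewrite primitiveK => <-.
  by move=> /(uniq_leq_size us); rewrite size_map size_iota.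
rewrite sum1.
set x := size r.
apply: (@le_trans _ _ (\sum_(b <- r) Num.sqrt x%:R / Num.sqrt (row_content b)%:R)).
  rewrite big_seq [leRHS]big_seq; apply: ler_sum => b br.
  have cb : 0 < (row_content b)%:R :> R by rewrite ltr0n row_content_gt0 // D0 //; case: (rP _ br).
  rewrite ler_pdivlMr ?sqrtr_gt0 // -sqrtrM // ler_wsqrtr // -natrM ler_nat mulnC.
  exact: kx.
rewrite -mulr_sumr.
(* Points of one ray have distinct contents, all between 1 and [x]. *)
have h : \sum_(b <- r) (Num.sqrt (row_content b)%:R)^-1 <=
    \sum_(1 <= j < x.+1) (Num.sqrt j%:R)^-1 :> R.
  rewrite -(big_map row_content predT (fun j => (Num.sqrt j%:R)^-1 : R)).
  have uc : uniq (map row_content r).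
    rewrite map_inj_in_uniq // => b b' /rP[_ bp] /rP[_ bp'] cc.
    by rewrite -(primitiveK b) -(primitiveK b') bp bp' cc.
  rewrite [leRHS](bigID (mem (map row_content r))) /=.
  rewrite -[leRHS]addr0 -[leLHS]addr0 -!addrA; apply: lerD; last first.
    by rewrite addr0 sumr_ge0 // => j _; rewrite invr_ge0 sqrtr_ge0.
  rewrite -[leRHS]big_filter le_eqVlt; apply/orP; left; apply/eqP/perm_big.
  apply: uniq_perm => //; first by rewrite filter_uniq // iota_uniq.
  move=> j; rewrite mem_filter mem_index_iota andb_idr // => /mapP[b br ->].
  rewrite row_content_gt0 ?ltnS; last by apply: D0; case: (rP _ br).
  apply: leq_trans (kx _ br); rewrite leq_pmulr // k0 //; by case: (rP _ br).
apply: le_trans (ler_wpM2l (sqrtr_ge0 _) (le_trans h (sum_inv_sqrt_le R x))) _.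
by rewrite mulrCA -expr2 sqr_sqrtr.
Qed.

(** * Chains of lattice points *)

Lemma ler_sum_inj (R : realType) (X Y : finType) (P : pred X) (f : X -> Y)
    (F : Y -> R) :
  {in P &, injective f} -> (forall y, 0 <= F y) ->
  \sum_(x | P x) F (f x) <= \sum_y F y.
Proof.
move=> finj F0; rewrite (partition_big f predT) //=; apply: ler_sum => y _.
have [x /andP[Px /eqP fx]|none] := pickP (fun x => P x && (f x == y)).
  rewrite (big_pred1 x) ?fx // => x'; apply/andP/eqP => [[Px' /eqP fx']|->].
    by apply: finj => //; rewrite fx' fx.
  by rewrite fx.
by rewrite big_pred0.
Qed.

Lemma ler_sum_ind_inj (R : realType) (X Y : finType) (P : pred X) (f : X -> Y)
    (a : R) : 0 < a ->
  {in P &, injective f} -> \sum_x (P x)%:R ^+ 2 / a <= #|Y|%:R / a.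
Proof.
move=> a0 finj; apply: (@le_trans _ _ (\sum_(x | P x) a^-1)).
  rewrite [leRHS]big_mkcond; apply: ler_sum => x _.
  by case: (P x); rewrite ?expr1n ?mul1r // expr0n mul0r.
have a1 : forall y : Y, 0 <= a^-1 by move=> _; rewrite invr_ge0 ltW.
apply: le_trans (ler_sum_inj _ _ _ P f (fun=> a^-1) finj a1) _.
by rewrite sumr_const -[leLHS]mulr_natl.
Qed.

(** Superblock, block and position act as digits: if [p < z], exactly one summand is 1, according to
    the first digit in which they differ. *)
Lemma prefix_split (p z n m : nat) :
  ((((p %/ n == z %/ n) && (p < z)) +
   (((p %/ n %/ m == z %/ n %/ m) && (p %/ n < z %/ n)) +
    (p %/ n %/ m < z %/ n %/ m))) = (p < z))%N.
Proof.
have [pz|zp] := ltnP p z; last first.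
  have h1 := leq_div2r n zp; have h2 := leq_div2r m h1.
  by rewrite andbF ltnNge h1 ltnNge h2 andbF.
have h1 := leq_div2r n (ltnW pz); have h2 := leq_div2r m h1.
case: (ltngtP (p %/ n) (z %/ n)) h1 => // [h _|-> _]; last by rewrite ?eqxx ?ltnn ?andbF ?ltnn.
by case: (ltngtP (p %/ n %/ m) (z %/ n %/ m)) h2.
Qed.

Section Chains.
Context {d : nat} (Om : {fset 'rV[int]_d}).
Implicit Types (b w : 'rV[int]_d).
Hypothesis Om_convex : forall w b i j, w \in Om -> w + b *+ j \in Om ->
  (i <= j)%N -> w + b *+ i \in Om.

(** The cut-off makes the maximum finite and loses nothing for [b != 0], by [line_lt]. For [b = 0]
    every point is its own root. *)
Definition chain_pos b w : nat := \max_(i < #|` Om|%fset | w - b *+ i \in Om) i.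

Definition chain_root b w := w - b *+ chain_pos b w.

Lemma chain_rootK b w : w = chain_root b w + b *+ chain_pos b w.
Proof. by rewrite /chain_root subrK. Qed.

Lemma chain_root_in b w : w \in Om -> chain_root b w \in Om.
Proof.
move=> wO; rewrite /chain_root /chain_pos; apply: (big_ind (fun i => w - b *+ i \in Om)) => //.
  by rewrite mulr0n subr0.
by move=> i j; rewrite /maxn; case: ifP.
Qed.

Lemma pos_lt b w : w \in Om -> (chain_pos b w < #|` Om|)%fset%N.
Proof.
move=> wO; rewrite /chain_pos.
apply: (big_ind (fun i => i < #|` Om|%fset)%N) => //.
  by rewrite cardfs_gt0; apply: contraTneq wO => ->; rewrite in_fset0.
by move=> i j; rewrite gtn_max => -> ->.
Qed.

Lemma line_lt b w i : b != 0 -> w \in Om -> w - b *+ i \in Om ->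
  (i < #|` Om|%fset)%N.
Proof.
move=> b0 wO wi.
have us : uniq [seq w - b *+ i + b *+ j | j <- iota 0 i.+1].
  rewrite map_inj_in_uniq ?iota_uniq // => j k _ _ /addrI /(congr1 row_content).
  by rewrite !content_muln => /eqP; rewrite eqn_pmul2r ?row_content_gt0 // => /eqP.
have : {subset [seq w - b *+ i + b *+ j | j <- iota 0 i.+1] <= Om}.
  move=> _ /mapP[j + ->]; rewrite mem_iota add0n ltnS => /andP[_ ji].
  by apply: Om_convex ji => //; rewrite subrK.
by move=> /(uniq_leq_size us); rewrite size_map size_iota.
Qed.

Lemma pos_max b w i : b != 0 -> w \in Om -> w - b *+ i \in Om -> (i <= chain_pos b w)%N.
Proof.
move=> b0 wO wi; have iN := line_lt _ _ _ b0 wO wi.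
exact: (leq_bigmax_cond (Ordinal iN) wi).
Qed.

Lemma pos_shift b w j : b != 0 -> w \in Om -> w + b *+ j \in Om ->
  chain_pos b (w + b *+ j) = (chain_pos b w + j)%N.
Proof.
move=> b0 wO wj; apply/eqP; rewrite eqn_leq; apply/andP; split; last first.
  apply: pos_max => //; rewrite mulrnDr opprD addrACA subrr addr0.
  exact: chain_root_in.
have := chain_root_in b _ wj; rewrite /chain_root; set p := chain_pos b _.
have [pj _|jp] := leqP p j; first exact: leq_trans pj (leq_addl _ _).
have -> : w + b *+ j - b *+ p = w - b *+ (p - j).
  by rewrite -{1}(subnK (ltnW jp)) mulrnDr opprD addrACA subrr addr0.
by rewrite addnC -leq_subLR; exact: pos_max.
Qed.

Lemma chain_root_shift b w j : b != 0 -> w \in Om -> w + b *+ j \in Om ->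
  chain_root b (w + b *+ j) = chain_root b w.
Proof.
move=> b0 wO wj; rewrite /chain_root pos_shift // mulrnDr opprD addrACA subrr addr0 //.
Qed.

(** Every nonempty progression is an interval of positions on one chain. Its step can be taken as a
    difference of two points of [Om], which keeps the union bound polynomial in the number of
    points. *)
Lemma AP_chain (S : {fset 'rV[int]_d}) (w0 : 'rV[int]_d) :
  S \in AP_family Om -> w0 \in S ->
  exists b (x y : nat), [/\ (x <= y)%N, (y <= #|` Om|%fset)%N,
    exists w1 w2, [/\ w1 \in Om, w2 \in Om & b = w2 - w1] &
    forall w, w \in Om -> (w \in S) =
      (chain_root b w == chain_root b w0) && (x <= chain_pos b w < y)%N].
Proof.
rewrite inE /= => /andP[SO /asboolP[a [b [l [l0 SE]]]]] w0S.
have SP w : w \in S <-> w \in Om /\ exists2 i, (i < l)%N & w = a + b *+ i.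
  have : [set` S] w <-> ([set` Om] `&` AP a b l) w by rewrite SE.
  move=> /= H; split=> [/H[h1 [i h2 h3]]|[h1 [i h2 h3]]].
    by split=> //; exists i.
  by apply/H; split=> //; exists i.
have [w0O [i0 i0l w0E]] := (SP w0).1 w0S.
have [S1|] := boolP (all (fun w => w == w0) S).
  (* A singleton is encoded by the step 0, whose chains are single points. *)
  exists 0, 0%N, #|` Om|%fset; split=> //.
    by exists w0, w0; rewrite subrr.
  move=> w wO; rewrite /chain_root !mul0rn !subr0 pos_lt // leq0n !andbT.
  apply/idP/eqP => [wS|->//].
  by move: S1 => /allP /(_ _ wS) /eqP.
move=> /allPn[w' w'S w'w0].
have [w'O [i' i'l w'E]] := (SP w').1 w'S.
have b0 : b != 0 by apply: contraNneq w'w0 => bz; rewrite w'E w0E bz !mul0rn.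
have ii : i' != i0 by apply: contraNneq w'w0 => ie; rewrite w'E w0E ie.
set p0 := chain_pos b w0.
have p0N : (p0 < #|` Om|%fset)%N by exact: pos_lt.
(* The subtraction is truncated: the progression may begin before the root of its chain. *)
exists b, (p0 - i0)%N, (minn (p0 + (l - i0)) #|` Om|%fset); split.
- by rewrite leq_min; apply/andP; split; lia.
- exact: geq_minr.
- have step u u' i i2 : u \in Om -> u' \in Om -> u = a + b *+ i -> u' = a + b *+ i2 ->
      (i < i2)%N -> exists w1 w2, [/\ w1 \in Om, w2 \in Om & b = w2 - w1].
    move=> uO u'O uE u'E lt.
    exists u, (u + b); split=> //; last by rewrite addrAC subrr add0r.
    rewrite -[b]mulr1n; apply: (Om_convex _ _ _ (i2 - i)) => //; last lia.
    by rewrite uE -addrA -mulrnDr subnKC -?u'E // ltnW.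
  have [lt|] := ltnP i0 i'; first exact: step w0O w'O w0E w'E lt.
  by rewrite leq_eqVlt (negbTE ii) /= => lt; exact: step w'O w0O w'E w0E lt.
move=> w wO; apply/idP/andP => [wS|[/eqP rE /andP[px py]]].
  have [_ [i il wE]] := (SP w).1 wS.
  have [ii0|i0i] := leqP i0 i.
    have E : w = w0 + b *+ (i - i0) by rewrite w0E -addrA -mulrnDr subnKC.
    have pE : chain_pos b w = (p0 + (i - i0))%N by rewrite E pos_shift // -E.
    split; first by rewrite E chain_root_shift // -E.
    have := pos_lt b _ wO; rewrite leq_min pE => ->; rewrite andbT; lia.
  have E : w0 = w + b *+ (i0 - i) by rewrite wE -addrA -mulrnDr subnKC // ltnW.
  have pE : p0 = (chain_pos b w + (i0 - i))%N by rewrite /p0 E pos_shift // -E.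
  split; first by rewrite E chain_root_shift // -E.
  have := pos_lt b _ wO; rewrite leq_min => ->; rewrite andbT; lia.
apply/SP; split=> //.
have {}py : (chain_pos b w < p0 + (l - i0))%N by apply: leq_trans py (geq_minl _ _).
exists (chain_pos b w + i0 - p0)%N; first lia.
rewrite {1}(chain_rootK b w) rE /chain_root -/p0 w0E.
have -> : a + b *+ i0 - b *+ p0 + b *+ chain_pos b w = a + (b *+ (chain_pos b w + i0) - b *+ p0).
  rewrite mulrnDr -!addrA; congr (_ + _).
  by rewrite [RHS]addrC -addrA addrCA addrA addrC addrA.
congr (_ + _); apply: (addIr (b *+ p0)); rewrite subrK -mulrnDr subnK //; lia.
Qed.

End Chains.

(** * Colouring arithmetic progressions *)

Section Core.
Context {R : realType} {d : nat} (G Om : {fset 'rV[int]_d}) (n : nat).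
Hypothesis n_gt0 : (0 < n)%N.
Hypothesis G_star : forall (b : 'rV[int]_d) i j,
  b *+ j \in G -> (i <= j)%N -> b *+ i \in G.
Hypothesis Om_convex : forall (w b : 'rV[int]_d) i j,
  w \in Om -> w + b *+ j \in Om -> (i <= j)%N -> w + b *+ i \in Om.
Hypothesis Om_sub : forall w w', w \in Om -> w' \in Om -> w - w' \in G.

(** With [G] the integer points of the difference body, these are the nonzero steps whose chains may
    have more than [n] points. *)
Definition steps : {fset 'rV[int]_d} :=
  [fset b in G | (b != 0) && (b *+ n \in G)]%fset.

Hypothesis steps_le : (#|` steps|%fset <= n)%N.

Definition reach (b : 'rV[int]_d) : nat :=
  \max_(k < #|` G|%fset | b *+ (n * k) \in G) k.

(** Of the order of the square root of the number of blocks in a chain, so that a chain has at most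
    [blocking b] superblocks, each of [blocking b] blocks. *)
Definition blocking (b : 'rV[int]_d) : nat :=
  (Num.truncn (Num.sqrt (2 * (reach b)%:R) : R)).+1.

Lemma stepsP b : b \in steps -> [/\ b \in G, b != 0 & b *+ n \in G].
Proof. by rewrite !inE /= => /and3P[]. Qed.

Lemma star_lt b i : b != 0 -> b *+ i \in G -> (i < #|` G|%fset)%N.
Proof.
move=> b0 bi.
have us : uniq [seq b *+ j | j <- iota 0 i.+1].
  rewrite map_inj_in_uniq ?iota_uniq // => j k _ _ /(congr1 row_content).
  by rewrite !content_muln => /eqP; rewrite eqn_pmul2r ?row_content_gt0 // => /eqP.
have : {subset [seq b *+ j | j <- iota 0 i.+1] <= G}.
  move=> _ /mapP[j + ->]; rewrite mem_iota add0n ltnS => /andP[_ ji].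
  exact: G_star ji.
by move=> /(uniq_leq_size us); rewrite size_map size_iota.
Qed.

Lemma reach_in b : b \in steps -> b *+ (n * reach b) \in G.
Proof.
move=> /stepsP[bG b0 bn]; apply: (big_ind (fun k => b *+ (n * k) \in G)) => //.
  by rewrite muln0; exact: G_star (leq0n n).
by move=> i j; rewrite /maxn; case: ifP.
Qed.

Lemma reach_max b k : b != 0 -> b *+ (n * k) \in G -> (k <= reach b)%N.
Proof.
move=> b0 bk; have kG : (k < #|` G|%fset)%N.
  by apply: leq_ltn_trans (star_lt _ _ b0 bk); exact: leq_pmull.
exact: (leq_bigmax_cond (Ordinal kG) bk).
Qed.

Lemma reach_gt0 b : b \in steps -> (0 < reach b)%N.
Proof. by move=> /stepsP[_ b0 bn]; apply: reach_max; rewrite ?muln1. Qed.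

Lemma pos_in b w : w \in Om -> b *+ chain_pos Om b w \in G.
Proof.
move=> wO; have := Om_sub _ _ wO (chain_root_in _ b _ wO).
by rewrite /chain_root opprB addrC subrK.
Qed.

Lemma pos_div_le b w : b != 0 -> w \in Om -> (chain_pos Om b w %/ n <= reach b)%N.
Proof.
move=> b0 wO; apply: reach_max => //; apply: G_star (pos_in b w wO) _.
by rewrite mulnC leq_trunc_div.
Qed.

Lemma blocking_sqr b : b \in steps -> (reach b < blocking b * blocking b)%N.
Proof.
move=> bs; rewrite -(ltr_nat R) natrM /blocking.
have k1 : 1 <= (reach b)%:R :> R by rewrite ler1n reach_gt0.
have k0 : 0 <= 2 * (reach b)%:R :> R by rewrite mulr_ge0.
have := truncn_itv (sqrtr_ge0 (2 * (reach b)%:R : R)) => /andP[_].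
have := sqr_sqrtr k0; have := sqrtr_ge0 (2 * (reach b)%:R : R).
move: (Num.sqrt _) => s; move: (Num.truncn s).+1%:R => t; nra.
Qed.

Lemma blocking_le b : b \in steps ->
  (blocking b)%:R <= 3 * Num.sqrt (reach b)%:R :> R.
Proof.
move=> bs; rewrite /blocking -natr1.
have k1 : 1 <= (reach b)%:R :> R by rewrite ler1n reach_gt0.
have k0 : 0 <= 2 * (reach b)%:R :> R by rewrite mulr_ge0.
have := truncn_itv (sqrtr_ge0 (2 * (reach b)%:R : R)) => /andP[h _].
have s1 : 1 <= Num.sqrt (reach b)%:R :> R by rewrite -[leLHS]sqrtr1 ler_wsqrtr.
suff : Num.sqrt (2 * (reach b)%:R) <= 2 * Num.sqrt (reach b)%:R :> R by lra.
rewrite sqrtrM // ler_wpM2r ?sqrtr_ge0 //.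
by rewrite -[leRHS]ger0_norm // -sqrtr_sqr ler_wsqrtr //; lra.
Qed.

(** [blocking] is at most three times the square root of [reach], and [sum_sqrt_multiples] sums
    these roots along the rays: [3 * 2 * n]. *)
Lemma sum_blocking_le : \sum_(b <- steps) (blocking b)%:R <= 6 * n%:R :> R.
Proof.
apply: (@le_trans _ _ (3 * \sum_(b <- steps) Num.sqrt (reach b)%:R)).
  rewrite mulr_sumr big_seq [leRHS]big_seq; apply: ler_sum => b; exact: blocking_le.
have := sum_sqrt_multiples R d steps reach.
have h1 b : b \in steps -> b != 0 by case/stepsP.
have h2 b i : b \in steps -> (0 < i)%N -> (i <= row_content b * reach b)%N ->
    primitive b *+ i \in steps.
  move=> bs i0 ib; have pn : primitive b *+ i *+ n \in G.
    rewrite -mulrnA; have := reach_in _ bs; rewrite -{1}(primitiveK b) -mulrnA.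
    by move=> /G_star; apply; rewrite mulnCA mulnC leq_mul2l ib orbT.
  rewrite !inE /= pn andbT; apply/andP; split.
    by rewrite -[X in X \in _]mulr1n; exact: G_star n_gt0.
  apply: contraTneq i0 => /(congr1 row_content).
  rewrite content_muln content_primitive ?h1 // muln1 => ->.
  by rewrite /row_content big1 // => j _; rewrite mxE.
move=> /(_ h1 h2 reach_gt0) h3.
have : (#|` steps|%fset)%:R <= n%:R :> R by rewrite ler_nat.
lra.
Qed.

Local Notation N := #|` Om|%fset.

(** Points, then blocks and superblocks given by step, root and index; the boolean is [true] for
    superblocks. *)
Definition atom : Type := (Om + steps * Om * 'I_N * bool)%type.

Definition atom_mem (j : atom) (i : Om) : bool :=
  match j with
  | inl k => k == i
  | inr (b, r, q, l) => (chain_root Om (val b) (val i) == val r) &&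
      ((if l then chain_pos Om (val b) (val i) %/ n %/ blocking (val b)
        else chain_pos Om (val b) (val i) %/ n) == q)%N
  end.

(** The weight bounds how many atoms of the given kind a prefix uses, so each kind adds at most 1 in
    [prefix_coef_norm]. *)
Definition atom_weight (j : atom) : R :=
  match j with
  | inl _ => n%:R
  | inr (b, _, _, _) => (blocking (val b))%:R
  end.

Definition prefix_mem (b r : 'rV[int]_d) (y : nat) (i : Om) : bool :=
  (chain_root Om b (val i) == r) && (chain_pos Om b (val i) < y)%N.

(* A prefix of length [y] is a union of whole superblocks, of whole blocks of
   the next superblock, and of points of the next block; [y] is first clipped
   so that there are at most [blocking b] superblocks. *)
Definition prefix_coef (b r : 'rV[int]_d) (y : nat) (j : atom) : bool :=
  let z := minn y ((reach b).+1 * n) in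
  if b \in steps then
    match j with
    | inl k => (chain_root Om b (val k) == r) &&
        ((chain_pos Om b (val k) %/ n == z %/ n) && (chain_pos Om b (val k) < z))%N
    | inr (b', r', q, l) => [&& val b' == b, val r' == r &
        if l then (q < z %/ n %/ blocking b)%N
        else ((q %/ blocking b == z %/ n %/ blocking b) && (q < z %/ n))%N]
    end
  else if j is inl k then prefix_mem b r y k else false.

Lemma atom_weight_gt0 j : 0 < atom_weight j.
Proof. by case: j => [k|[[[b r] q] l]] /=; rewrite ltr0n. Qed.

(** A point is one atom of weight [n] and lies, for each exceptional step, in at most one block and
    one superblock: [n + 2 * 6 * n]. *)
Lemma atom_degree i : \sum_(j | atom_mem j i) atom_weight j <= 13 * n%:R.
Proof.
rewrite big_sumType /= (big_pred1 i) // -[13]/(1 + 12)%:R natrD mulrDl mul1r lerD2l.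
pose f (x : steps * Om * 'I_N * bool) : steps * bool := (x.1.1.1, x.2).
pose F (y : steps * bool) : R := (blocking (val y.1))%:R.
apply: (@le_trans _ _ (\sum_y F y)).
  apply: le_trans (ler_sum_inj _ _ _ (fun x => atom_mem (inr x) i) f F _ _) => //.
    by apply: ler_sum => -[[[b r] q] l].
  move=> [[[b r] q] l] [[[b' r'] q'] l']; rewrite !unfold_in /=.
  move=> /andP[/eqP e1 /eqP e2] /andP[/eqP e1' /eqP e2'] [bb ll].
  rewrite {}bb {}ll in e1 e2 *.
  have -> : r = r' by apply: val_inj; rewrite /= -e1 -e1'.
  by have -> : q = q' by apply: val_inj; rewrite /= -e2 -e2'.
rewrite -(pair_bigA _ (fun b l => F (b, l))) /=.
under eq_bigr do rewrite big_bool /F /= -mulr2n -[_ *+ 2]mulr_natl.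
rewrite -mulr_sumr -[12]/(2 * 6)%:R natrM -mulrA ler_wpM2l //.
by have := sum_blocking_le; rewrite big_seq_fsetE.
Qed.

(** Only the point, its block [x1] and its superblock [x2] can contribute, and [prefix_split] says
    that one of them does exactly when the point is in the prefix. *)
Lemma prefix_decomposition b r y i :
  \sum_(j | atom_mem j i) (prefix_coef b r y j)%:R = (prefix_mem b r y i)%:R :> R.
Proof.
rewrite big_sumType /= (big_pred1 i) //= /prefix_coef.
case: ifPn => bs; last by rewrite big1 // addr0.
set z := minn _ _; set p := chain_pos Om b (val i).
rewrite /prefix_mem -/p.
have b0 : b != 0 by case: (stepsP _ bs).
(* Clipping changes nothing: no position reaches [(reach b).+1 * n]. *)
have pz : (p < y)%N = (p < z)%N.
  rewrite leq_min; case: (p < y)%N => //=; apply/esym.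
  by rewrite -ltn_divLR // ltnS pos_div_le // (valP i).
have rO := chain_root_in _ b _ (valP i).
have [e|ne] := eqVneq (chain_root Om b (val i)) r; last first.
  rewrite add0r big1 // => -[[[b' r'] q] l] /= /andP[/eqP e1 _].
  by case: eqP => // e; case: eqP => // e2; rewrite -e -e2 e1 e2 eqxx in ne *.
have pN : (p < N)%N by exact: pos_lt (valP i).
have q1N : (p %/ n < N)%N by exact: leq_ltn_trans (leq_div _ _) pN.
have q2N : (p %/ n %/ blocking b < N)%N by exact: leq_ltn_trans (leq_div _ _) q1N.
pose x1 : steps * Om * 'I_N * bool := ([` bs]%fset, [` rO]%fset, Ordinal q1N, false).
pose x2 : steps * Om * 'I_N * bool := ([` bs]%fset, [` rO]%fset, Ordinal q2N, true).
have E1 : atom_mem (inr x1) i by rewrite /= -/p !eqxx.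
have E2 : atom_mem (inr x2) i by rewrite /= -/p !eqxx.
have E12 : x2 != x1 by rewrite /x1 /x2 xpair_eqE /= andbF.
rewrite (bigD1 x1) // (bigD1 x2) /=; last by rewrite E12 andbT; exact: E2.
rewrite big1 => [|[[[b' r'] q] l]]; last first.
  move=> /= /andP[/andP[/andP[/eqP e1 /eqP e2] n1] n2].
  case: eqP => // eb; case: eqP => // er; exfalso.
  have E1' : b' = [` bs]%fset by apply: val_inj.
  have E2' : r' = [` rO]%fset by apply: val_inj; rewrite /= er.
  rewrite {}eb -/p in e2; case: l e2 n1 n2 => e2 n1 n2.
    by case/eqP: n2; rewrite /x2 E1' E2'; congr (_, _, _); apply: val_inj.
  by case/eqP: n1; rewrite /x1 E1' E2'; congr (_, _, _); apply: val_inj.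
rewrite addr0 e !eqxx /= pz -!natrD; congr (_%:R); exact: prefix_split.
Qed.

(** A chain of a non-exceptional nonzero step has at most [n] points, and a chain of step 0 only
    one. *)
Lemma pos_mod_inj b r y : b \notin steps -> 
  {in prefix_mem b r y &, injective (fun k : Om => chain_pos Om b (val k) %% n)%N}.
Proof.
move=> bs k k'; rewrite !unfold_in => /andP[/eqP e _] /andP[/eqP e' _] pp.
have [b0|b0] := eqVneq b 0.
  apply: val_inj; move: e e'; rewrite /chain_root b0 !mul0rn !subr0.
  by move=> /= -> ->.
have small (w : Om) : (chain_pos Om b (val w) < n)%N.
  rewrite ltnNge; apply: contra bs => np.
  have h := pos_in b _ (valP w).
  have := G_star _ 1 _ h (leq_trans n_gt0 np); rewrite mulr1n => bG.
  by rewrite !inE /= b0 bG (G_star _ _ _ h np).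
move: pp; rewrite !modn_small // => pp.
by apply: val_inj; rewrite /= (chain_rootK Om b (val k)) (chain_rootK Om b (val k')) e e' pp.
Qed.

Lemma prefix_coef_norm b r y :
  \sum_j (prefix_coef b r y j)%:R ^+ 2 / atom_weight j <= 3 :> R.
Proof.
have nn : 0 < n%:R :> R by rewrite ltr0n.
pose f (k : Om) : 'I_n := Ordinal (ltn_pmod (chain_pos Om b (val k)) n_gt0).
rewrite big_sumType /= /prefix_coef; case: (boolP (b \in steps)) => bs; last first.
  rewrite [X in _ + X]big1 ?addr0; last by move=> x _; rewrite expr0n mul0r.
  apply: le_trans (ler_sum_ind_inj R _ _ (prefix_mem b r y) f _ nn _) _.
    by move=> k k' kP kP' /(congr1 val) /=; exact: (pos_mod_inj b r y bs).
  by rewrite card_ord divff ?gt_eqF // ler1n.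
set z := minn _ _.
have m0 : (0 < blocking b)%N by [].
have mm : 0 < (blocking b)%:R :> R by rewrite ltr0n.
have -> : 3 = 1 + 2 :> R by ring.
apply: lerD.
  apply: le_trans (ler_sum_ind_inj R _ _ (fun k : Om =>
    (chain_root Om b (val k) == r) && ((chain_pos Om b (val k) %/ n == z %/ n) &&
       (chain_pos Om b (val k) < z))%N) f _ nn _) _.
    move=> k k'; rewrite !unfold_in => /and3P[/eqP e /eqP d1 _] /and3P[/eqP e' /eqP d2 _].
    move=> /(congr1 val) /= mE; apply: val_inj.
    rewrite /= (chain_rootK Om b (val k)) (chain_rootK Om b (val k')) e e'.
    congr (_ + _ *+ _).
    by rewrite (divn_eq (chain_pos Om b (val k)) n) (divn_eq (chain_pos Om b (val k')) n) d1 d2 mE.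
  by rewrite card_ord divff ?gt_eqF.
pose P (x : steps * Om * 'I_N * bool) := [&& val x.1.1.1 == b, val x.1.1.2 == r &
  if x.2 then (x.1.2 < z %/ n %/ blocking b)%N
  else ((x.1.2 %/ blocking b == z %/ n %/ blocking b) && (x.1.2 < z %/ n))%N].
pose g (x : steps * Om * 'I_N * bool) : 'I_(blocking b) * bool :=
  (Ordinal (ltn_pmod x.1.2 m0), x.2).
have ginj : {in P &, injective g}.
  move=> [[[b1 r1] q1] l1] [[[b2 r2] q2] l2]; rewrite !unfold_in /P /=.
  move=> /and3P[/eqP e1 /eqP f1 h1] /and3P[/eqP e2 /eqP f2 h2] [/= mE lE].
  have -> : b1 = b2 by apply: val_inj; rewrite /= e1 e2.
  have -> : r1 = r2 by apply: val_inj; rewrite /= f1 f2.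
  rewrite -{}lE in h2 *; congr (_, _, _); apply: val_inj => /=.
  (* This is where the clipping of [y] is used: fewer superblocks than this bound are selected, so
     their indices stay distinct modulo [blocking b]. *)
  have zm : (z %/ n %/ blocking b <= blocking b)%N.
    apply: leq_trans (_ : (reach b).+1 %/ blocking b <= _)%N.
      apply: leq_div2r; rewrite -(mulnK (reach b).+1 n_gt0); apply: leq_div2r.
      exact: geq_minr.
    by rewrite -[leqRHS](mulnK _ m0); apply: leq_div2r; exact: blocking_sqr.
  case: l1 h1 h2 => [h1 h2|/andP[/eqP h1 _] /andP[/eqP h2 _]].
    by move: mE; rewrite !modn_small // (leq_trans _ zm).
  by rewrite (divn_eq q1 (blocking b)) (divn_eq q2 (blocking b)) h1 h2 mE.
apply: le_trans (le_trans _ (ler_sum_ind_inj R _ _ P g _ mm ginj)) _.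
  apply: ler_sum => -[[[b1 r1] q1] l1] _; rewrite /P /=.
  by case: eqP => [->|_] //=; rewrite expr0n !mul0r.
by rewrite card_prod card_ord card_bool mulnC natrM mulfK ?gt_eqF.
Qed.

Lemma coloring_sumE (chi : coloring Om) (S : {fset 'rV[int]_d}) :
  (`|coloring_sum chi S|%N)%:R =
  `|\sum_(i : Om) (-1) ^+ chi i * (val i \in S)%:R| :> R.
Proof.
rewrite natr_absz intr_norm /coloring_sum rmorph_sum /= big_mkcond.
congr `|_|; apply: eq_bigr => i _; rewrite rmorphXn rmorphN1.
by case: (val i \in S); rewrite ?mulr1 ?mulr0.
Qed.

Lemma AP_coloring : exists chi : coloring Om, forall S, S \in AP_family Om ->
  (`|coloring_sum chi S|%N)%:R <=
    160 * Num.sqrt n%:R * Num.sqrt (ln (1 + N%:R)) :> R.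
Proof.
have [N0|N0] := posnP N.
  exists [ffun=> false] => S _; rewrite coloring_sumE big1 ?normr0.
    by rewrite !mulr_ge0 ?sqrtr_ge0.
  by move=> [i iO]; move: (iO); rewrite (cardfs0_eq N0).
have N1 : 1 <= N%:R :> R by rewrite ler1n.
pose L : R := ln (1 + N%:R).
have L0 : 0 < L by rewrite ln_gt0 // ltrDl; lra.
have nn : 0 < n%:R :> R by rewrite ltr0n.
(* A prefix is coded by two points whose difference is the step, by its root and by its length;
   there are polynomially many. *)
pose Q := (Om * Om * Om * 'I_N.+1)%type.
pose c (q : Q) (j : atom) : R :=
  (prefix_coef (val q.1.1.2 - val q.1.1.1) (val q.1.2) q.2 j)%:R.
have cardQ : 2 * #|{: Q}|%:R <= expR (5 * L).
  rewrite [5 * L]mulrC expRM_natr lnK ?posrE ?addr_gt0 //; last lra.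
  rewrite !card_prod card_ord -!cardfE !natrM.
  rewrite exprS exprSr -natr1 [_ + 1]addrC.
  have N4 : N%:R * N%:R * N%:R <= (1 + N%:R) ^+ 3 :> R.
    rewrite !exprS expr0 mulr1 mulrA; do 2?apply: ler_pM; rewrite ?mulr_ge0 //; lra.
  apply: ler_pM; rewrite ?mulr_ge0 //; first lra.
  by apply: ler_pM; rewrite ?mulr_ge0 //; lra.
have s0 : 0 < 13 * n%:R :> R by rewrite mulr_gt0.
have L50 : 0 < 5 * L by rewrite mulr_gt0.
have [z zP] := decomposition_discrepancy R Om atom Q (fun j i => atom_mem j i)
  atom_weight c (13 * n%:R) 3 (5 * L) atom_weight_gt0 s0 (ltr0Sn _ 2) L50
  atom_degree (fun q => prefix_coef_norm _ _ _) cardQ.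
exists [ffun i => z i] => S SA; rewrite coloring_sumE.
under eq_bigr do rewrite ffunE.
set B := 2 * Num.sqrt _ in zP.
have BE : 2 * B <= 160 * Num.sqrt n%:R * Num.sqrt L.
  (* [1560] is [8 * (13 * 3) * 5], and its root is below 40. *)
  have -> : B = 2 * (Num.sqrt 1560 * (Num.sqrt n%:R * Num.sqrt L)).
    rewrite -sqrtrM ?ler0n // -sqrtrM; last exact: ler0n.
    by rewrite /B; congr (2 * Num.sqrt _); ring.
  have : Num.sqrt 1560 <= 40 :> R.
    apply: (@le_trans _ _ (Num.sqrt (40 ^+ 2))).
      by apply: ler_wsqrtr; lra.
    by rewrite sqrtr_sqr ger0_norm ?ler0n.
  have : 0 <= Num.sqrt n%:R * Num.sqrt L by rewrite mulr_ge0 ?sqrtr_ge0.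
  rewrite -!mulrA; nra.
have B0 : 0 <= B by rewrite mulr_ge0 ?sqrtr_ge0.
apply: le_trans BE.
have [S0|[w0 w0S]] := fset_0Vmem S.
  rewrite big1 ?normr0 ?mulr_ge0 // => i _; rewrite S0 in_fset0 mulr0 //.
have [b [x [y [xy yN [w1 [w2 [w1O w2O bE]]] SE]]]] := AP_chain Om Om_convex S w0 SA w0S.
have w0O : w0 \in Om.
  move: SA; rewrite inE /= => /andP[_ /asboolP[a [b' [l [_ SE']]]]].
  by have : [set` S] w0 by []; rewrite SE' => -[].
have rO : chain_root Om b w0 \in Om by exact: chain_root_in.
have bound k : (k <= N)%N -> `|\sum_(i : Om) (-1) ^+ z i *
    (prefix_mem b (chain_root Om b w0) k i)%:R| <= B.
  rewrite -ltnS => kN.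
  have := zP ([` w1O]%fset, [` w2O]%fset, [` rO]%fset, Ordinal kN).
  congr (`| _ | <= B); apply: eq_bigr => i _; congr (_ * _).
  by rewrite -prefix_decomposition /c /= bE.
(* An interval of positions is the difference of two prefixes. *)
have -> : \sum_(i : Om) (-1) ^+ z i * (val i \in S)%:R =
   \sum_(i : Om) (-1) ^+ z i * (prefix_mem b (chain_root Om b w0) y i)%:R
   - \sum_(i : Om) (-1) ^+ z i * (prefix_mem b (chain_root Om b w0) x i)%:R :> R.
  rewrite -sumrB; apply: eq_bigr => i _; rewrite -mulrBr; congr (_ * _).
  rewrite SE ?(valP i) // /prefix_mem; case: (_ == _); rewrite /= ?subrr //.
  have [px|px] := leqP x; first by rewrite subr0.
  by rewrite (leq_trans px xy) subrr.
apply: le_trans (ler_normB _ _) _; rewrite [2 * B]mulr_natl mulr2n.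
by apply: lerD; apply: bound => //; apply: leq_trans yN.
Qed.

End Core.

(** * Convex bodies and lattice points *)

Definition dilate {R : realType} {d : nat} (a : R) (L : set 'rV[R]_d) :
  set 'rV[R]_d := [set a *: x | x in L].

Definition of_int {R : realType} {d : nat} (z : 'rV[int]_d) : 'rV[R]_d :=
  map_mx intr z.

Section OfInt.
Context {R : realType} {d : nat}.
Local Notation "z %:v" := (of_int z : 'rV[R]_d) (at level 2, format "z %:v").

Lemma of_intD (z w : 'rV[int]_d) : (z + w)%:v = z%:v + w%:v.
Proof. exact: map_mxD. Qed.

Lemma of_intB (z w : 'rV[int]_d) : (z - w)%:v = z%:v - w%:v.
Proof. exact: map_mxB. Qed.

Lemma of_intMn (z : 'rV[int]_d) k : (z *+ k)%:v = k%:R *: z%:v.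
Proof. by rewrite /of_int raddfMn scaler_nat. Qed.

Lemma of_int0 : (0 : 'rV[int]_d)%:v = 0.
Proof. exact: map_mx0. Qed.

Lemma entry_le_norm (x : 'rV[R]_d) j : `|x 0 j| <= `|x|.
Proof.
have -> : `|x| = mx_norm x by [].
rewrite mx_normrE.
exact: (le_bigmax _ (fun ij : 'I_1 * 'I_d => `|x ij.1 ij.2|) (0, j)).
Qed.

Lemma bounded_setP (A : set 'rV[R]_d) : bounded_set A ->
  exists2 M, 0 < M & forall x, A x -> `|x| <= M.
Proof.
move=> [M0 [_ h]]; exists (`|M0| + 1); first by rewrite ltr_wpDl.
by move=> x; apply: h; rewrite (le_lt_trans (ler_norm _)) // ltrDl.
Qed.

Lemma bounded_setI (A : set 'rV[R]_d) M :
  (forall x, A x -> `|x| <= M) -> bounded_set A.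
Proof.
move=> h; exists M; split; first exact: num_real.
by move=> y My x /h /le_trans; apply; exact: ltW.
Qed.

Lemma finite_int_points (A : set 'rV[R]_d) :
  bounded_set A -> finite_set [set z : 'rV[int]_d | A z%:v].
Proof.
move=> /bounded_setP[M M0 AM]; pose B := (Num.truncn M).+1.
pose g (f : {ffun 'I_d -> 'I_(B + B).+1}) : 'rV[int]_d :=
  \row_j ((f j)%:Z - B%:Z).
apply: (@sub_finite_set _ _ (g @` [set: {ffun 'I_d -> 'I_(B + B).+1}])); last first.
  exact/finite_image/finite_finset.
move=> z /= /AM zM.
have zB j : (`|z 0 j| <= B%:Z)%R.
  have : `|(z%:v) 0 j| < B%:R :> R.
    apply: le_lt_trans (entry_le_norm _ j) (le_lt_trans zM _).
    by have /andP[] := truncn_itv (ltW M0).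
  by rewrite mxE -intr_norm -[B%:R]/(B%:Z%:~R) ltr_int => /ltW.
exists [ffun j => inord (absz (z 0 j + B%:Z))] => //.
apply/rowP => j; rewrite mxE ffunE inordK.
  have := zB j; lia.
by have := zB j; lia.
Qed.

Lemma lattice_pointsP (A : set 'rV[R]_d) z : bounded_set A ->
  (z \in lattice_points A) <-> A z%:v.
Proof.
move=> /finite_int_points h; rewrite /lattice_points in_fset_set //.
by split=> [/set_mem|/mem_set].
Qed.

Lemma lattice_points_sub (A B : set 'rV[R]_d) : bounded_set B -> A `<=` B ->
  (lattice_points A `<=` lattice_points B)%fset.
Proof.
move=> Bb AB; apply/fsubsetP => z.
have Ab : bounded_set A.
  have [M _ BM] := bounded_setP _ Bb.
  by apply: (bounded_setI _ M) => x /AB /BM.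
by move=> /(lattice_pointsP _ _ Ab)/AB/(lattice_pointsP _ _ Bb).
Qed.

End OfInt.

Section Body.
Context {R : realType} {d : nat} (K : set 'rV[R]_d).
Hypothesis K_body : convex_body K.
Local Notation L := (difference_body K).
Local Notation "z %:v" := (of_int z : 'rV[R]_d) (at level 2, format "z %:v").

Lemma body_conv x y t : K x -> K y -> 0 <= t -> t <= 1 -> K (t *: x + (1 - t) *: y).
Proof.
case: K_body => Kc _ _ _ Kx Ky t0 t1.
have := Kc x y (Itv01 t0 t1); rewrite !inE; exact.
Qed.

Lemma body_nonempty : exists x, K x.
Proof. by case: K_body => _ _ _ [x /interior_subset Kx]; exists x. Qed.

Lemma diff0 : L 0.
Proof.
have [x Kx] := body_nonempty.
by exists x => //; exists x => //; rewrite subrr.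
Qed.

Lemma diff_opp x : L x -> L (- x).
Proof. by move=> [y Ky [z Kz <-]]; exists z => //; exists y => //; rewrite opprB. Qed.

Lemma diff_conv x y t : L x -> L y -> 0 <= t -> t <= 1 -> L (t *: x + (1 - t) *: y).
Proof.
move=> [x1 Kx1 [x2 Kx2 <-]] [y1 Ky1 [y2 Ky2 <-]] t0 t1.
exists (t *: x1 + (1 - t) *: y1); first exact: body_conv.
exists (t *: x2 + (1 - t) *: y2); first exact: body_conv.
by rewrite !scalerBr opprD addrACA.
Qed.

Lemma dilate1 x : dilate 1 L x <-> L x.
Proof.
split=> [[y Ly <-]|Lx]; first by rewrite scale1r.
by exists x => //; rewrite scale1r.
Qed.

Lemma dilateZ a b x : dilate b L x -> dilate (a * b) L (a *: x).
Proof. by move=> [y Ly <-]; exists y => //; rewrite scalerA. Qed.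

Lemma dilateN a x : dilate a L x -> dilate a L (- x).
Proof. by move=> [y /diff_opp Ly <-]; exists (- y) => //; rewrite scalerN. Qed.

Lemma dilate_mono a b x : 0 <= a -> a <= b -> dilate a L x -> dilate b L x.
Proof.
move=> a0 ab [y Ly <-]; have [b0|b0] := eqVneq b 0.
  exists 0; first exact: diff0.
  by rewrite scaler0 (_ : a = 0) ?scale0r //; lra.
have bp : 0 < b by rewrite lt_def b0 (le_trans a0).
exists ((a / b) *: y); last by rewrite scalerA mulrC divfK.
rewrite -[X in L X]addr0 -(scaler0 _ (1 - a / b)).
apply: diff_conv => //; first exact: diff0.
  by rewrite divr_ge0 // ltW.
by rewrite ler_pdivrMr // mul1r.
Qed.

Lemma dilateD a b x y : 0 <= a -> 0 <= b -> dilate a L x -> dilate b L y ->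
  dilate (a + b) L (x + y).
Proof.
move=> a0 b0 Lx Ly; have [ab|ab] := eqVneq (a + b) 0.
  have [az bz] : a = 0 /\ b = 0 by split; lra.
  move: Lx Ly; rewrite az bz => -[u _ <-] [w _ <-].
  by exists 0; [exact: diff0|rewrite !scale0r scaler0 addr0].
have abp : 0 < a + b by rewrite lt_def ab addr_ge0.
move: Lx Ly => [u Lu <-] [w Lw <-].
exists ((a / (a + b)) *: u + (1 - a / (a + b)) *: w).
  apply: diff_conv => //; first by rewrite divr_ge0 // ltW.
  by rewrite ler_pdivrMr // mul1r lerDl.
rewrite scalerDr !scalerA; congr (_ *: _ + _ *: _); field => //.
Qed.

Lemma dilate_bounded a : bounded_set (dilate a L).
Proof.
case: K_body => _ _ /bounded_setP[M M0 KM] _.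
apply: (bounded_setI _ (`|a| * (M + M))) => _ [_ [x Kx [y Ky <-]] <-].
rewrite normrZ ler_wpM2l //; apply: le_trans (ler_normB _ _) _.
by apply: lerD; exact: KM.
Qed.

Lemma translate_bounded v : bounded_set (translate v K).
Proof.
case: K_body => _ _ /bounded_setP[M M0 KM] _.
apply: (bounded_setI _ (`|v| + M)) => _ [x Kx <-].
apply: le_trans (ler_normD _ _) _; rewrite lerD2l; exact: KM.
Qed.

Lemma OmegaP v z : (z \in Omega v K) <-> exists2 x, K x & v + x = z%:v.
Proof. exact: (lattice_pointsP _ _ (translate_bounded v)). Qed.

Lemma dilate_latticeP a z : (z \in lattice_points (dilate a L)) <-> dilate a L z%:v.
Proof. exact: (lattice_pointsP _ _ (dilate_bounded a)). Qed.

Lemma zeta_ge1 a : (0 < zeta L a)%N.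
Proof.
rewrite /zeta cardfs_gt0; apply/fset0Pn; exists 0; apply/dilate_latticeP.
by rewrite of_int0; exists 0; [exact: diff0|rewrite scaler0].
Qed.

Lemma zeta_mono a b : 0 <= a -> a <= b -> (zeta L a <= zeta L b)%N.
Proof.
move=> a0 ab; apply/fsubset_leq_card/lattice_points_sub; first exact: dilate_bounded.
by move=> x; exact: dilate_mono.
Qed.

Local Notation good := [set s : R | 0 < s /\ (zeta L s^-1)%:R <= s].

Lemma good_nonempty : good !=set0.
Proof.
have z1 : 1 <= (zeta L 1)%:R :> R by rewrite ler1n zeta_ge1.
have z0 : 0 < (zeta L 1)%:R :> R by lra.
exists (zeta L 1)%:R; split=> //; rewrite ler_nat; apply: zeta_mono.
  by rewrite invr_ge0 ltW.
by rewrite invf_le1.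
Qed.

Lemma sstar_ge1 : 1 <= sstar K.
Proof.
apply: lb_le_inf; first exact: good_nonempty.
by move=> s [_]; apply: le_trans; rewrite ler1n zeta_ge1.
Qed.

Lemma zeta_le_above s : sstar K < s -> (zeta L s^-1)%:R <= s.
Proof.
move=> /(inf_lt good_nonempty)[t [t0 tz] ts].
apply: le_trans (le_trans tz (ltW ts)); rewrite ler_nat; apply: zeta_mono.
  by rewrite invr_ge0 ltW // (lt_trans t0).
by rewrite lef_pV2 ?posrE // ?ltW // (lt_trans t0).
Qed.

Lemma zeta_gt_below s : 0 < s -> s < sstar K -> s < (zeta L s^-1)%:R.
Proof.
move=> s0 ss; rewrite ltNge; apply/negP => h.
have : sstar K <= s.
  apply: ge_inf; first by exists 0 => t [t0 _]; exact: ltW.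
  by split.
by rewrite leNgt ss.
Qed.

Lemma disc_AP_le v : (disc_AP v K)%:R <=
  320 * Num.sqrt (ln (1 + (#|` Omega v K|%fset)%:R)) * f_body K.
Proof.
(* [n] exceeds [sstar K], so [zeta_le_above] applies to it, and [n <= 3 * sstar K] because
   [sstar K >= 1]. *)
have s1 := sstar_ge1; pose n := (Num.truncn (2 * sstar K)).+1.
have s20 : 0 <= 2 * sstar K by lra.
have /andP[n_le n_gt] := truncn_itv s20; rewrite -/n in n_gt.
have nle : n%:R <= 3 * sstar K by rewrite /n -natr1; lra.
have n0 : 0 < n%:R :> R by rewrite ltr0n.
pose G := lattice_points (dilate 1 L).
have GP z : z \in G <-> L z%:v by rewrite dilate_latticeP dilate1.
have G_star (b : 'rV[int]_d) i j : b *+ j \in G -> (i <= j)%N -> b *+ i \in G.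
  move=> /GP/dilate1 h ij; apply/GP/dilate1; have [j0|j0] := posnP j.
    by move: ij h; rewrite j0 leqn0 => /eqP ->.
  have j0' : 0 < j%:R :> R by rewrite ltr0n.
  have -> : (b *+ i)%:v = (i%:R / j%:R) *: (b *+ j)%:v.
    by rewrite !of_intMn scalerA divfK ?gt_eqF.
  apply: (dilate_mono (i%:R / j%:R * 1)).
  - by rewrite mulr1 divr_ge0.
  - by rewrite mulr1 ler_pdivrMr // mul1r ler_nat.
  - exact: dilateZ.
have Om_convex (w b : 'rV[int]_d) i j : w \in Omega v K ->
    w + b *+ j \in Omega v K -> (i <= j)%N -> w + b *+ i \in Omega v K.
  move=> /OmegaP[x Kx xE] /OmegaP[y Ky yE] ij; have [j0|j0] := posnP j.
    by move: ij; rewrite j0 leqn0 => /eqP->; apply/OmegaP; exists x; rewrite // mulr0n addr0.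
  have j0' : 0 < j%:R :> R by rewrite ltr0n.
  apply/OmegaP; exists ((i%:R / j%:R) *: y + (1 - i%:R / j%:R) *: x).
    apply: body_conv => //.
    by rewrite ler_pdivrMr // mul1r ler_nat.
  move: yE; rewrite !of_intD !of_intMn => yE.
  have -> : y = x + j%:R *: b%:v by apply: (addrI v); rewrite yE addrA xE.
  rewrite scalerDr scalerA divfK ?gt_eqF // scalerBl scale1r -xE -[RHS]addrA.
  by congr (_ + _); rewrite [x - _]addrC addrACA subrr add0r addrC.
have Om_sub w w' : w \in Omega v K -> w' \in Omega v K -> w - w' \in G.
  move=> /OmegaP[x Kx xE] /OmegaP[y Ky yE]; apply/GP.
  exists x => //; exists y => //.
  by rewrite of_intB -xE -yE opprD addrACA subrr add0r.
(* If [n b] lies in [L], then [b] lies in [L] dilated by [1 / n]. *)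
have steps_le : (#|` steps G n|%fset <= n)%N.
  rewrite -(ler_nat R); apply: le_trans (zeta_le_above n%:R _); last first.
    by apply: le_lt_trans n_gt; lra.
  rewrite ler_nat; apply: fsubset_leq_card; apply/fsubsetP => b.
  move=> /stepsP[_ _ /GP h]; apply/dilate_latticeP.
  by exists ((b *+ n)%:v) => //; rewrite of_intMn scalerA mulVf ?scale1r // gt_eqF.
have [chi chiP] := @AP_coloring R d G (Omega v K) n isT G_star Om_convex Om_sub steps_le.
have sn : Num.sqrt n%:R <= 2 * f_body K.
  rewrite /f_body -[2 in leRHS](@ger0_norm R) // -sqrtr_sqr -sqrtrM ?sqr_ge0 //.
  apply: ler_wsqrtr; lra.
set lg := Num.sqrt (ln _) in chiP *.
have lg0 : 0 <= lg by exact: sqrtr_ge0.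
have -> : 320 * lg * f_body K = 160 * (2 * f_body K) * lg by ring.
apply: (@le_trans _ _ (160 * Num.sqrt n%:R * lg)); last first.
  by apply: ler_wpM2r => //; apply: ler_wpM2l.
apply: (@le_trans _ _ (coloring_disc (AP_family (Omega v K)) chi)%:R).
  rewrite ler_nat /disc_AP /disc; case: arg_minnP => // chi0 _; exact.
rewrite /coloring_disc big_seq.
apply: (big_ind (fun x : nat => x%:R <= 160 * Num.sqrt n%:R * lg)) => //.
- by rewrite !mulr_ge0 ?sqrtr_ge0.
- by move=> x y hx hy; rewrite /maxn; case: ifP.
Qed.

End Body.

(** * The lower bound *)

Section Energy.
Context {R : realType} {V : zmodType} (Om : {fset V}) (f : V -> R).
Hypothesis f_supp : forall x, x \notin Om -> f x = 0.

Lemma sum_shift (U : {fset V}) (g : V -> R) h :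
  (forall x, x \notin Om -> g x = 0) -> (forall x, x \in Om -> x - h \in U) ->
  \sum_(a <- U) g (a + h) = \sum_(x <- Om) g x.
Proof.
move=> g0 OU; rewrite -(big_map (fun a => a + h) predT g) /=.
rewrite (bigID (mem Om)) /= [X in _ + X]big1_seq ?addr0; last first.
  by move=> x /andP[/g0].
rewrite -big_filter; apply: perm_big; apply: uniq_perm.
- by rewrite filter_uniq // map_inj_uniq ?fset_uniq //; exact: addIr.
- exact: fset_uniq.
move=> x; rewrite mem_filter andb_idr // => xO.
by apply/mapP; exists (x - h); [exact: OU|rewrite subrK].
Qed.

Lemma sum_corr (U : {fset V}) h h' : (forall x, x \in Om -> x - h \in U) ->
  \sum_(a <- U) f (a + h) * f (a + h') = \sum_(x <- Om) f x * f (x + (h' - h)).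
Proof.
move=> OU; rewrite -(sum_shift U (fun x => f x * f (x + (h' - h))) h) //.
  by apply: eq_bigr => a _; rewrite -[X in _ = _ * f X]addrA [h + _]addrC subrK.
by move=> x /f_supp->; rewrite mul0r.
Qed.

(* Expanding the squares, the pair [(i, i')] of indices contributes the
   correlations of [f] at the shifts [(i' - i) (b j - b k)], whose sum over
   [j] and [k] is a sum of squares; only the pairs [i = i'] are kept. *)
Lemma energy_ge (A : {fset V}) n l (b : 'I_n -> V) :
  (forall x j k i, x \in Om -> (i < l)%N -> x - (b j - b k) *+ i \in A) ->
  l%:R * n%:R ^+ 2 * \sum_(x <- Om) f x ^+ 2 <=
  \sum_j \sum_k \sum_(a <- A) (\sum_(i < l) f (a + (b j - b k) *+ i)) ^+ 2.
Proof.
move=> hA.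
pose T (i i' : 'I_l) := \sum_j \sum_k \sum_(x <- Om)
  f x * f (x + ((b j - b k) *+ i' - (b j - b k) *+ i)).
have -> : \sum_j \sum_k \sum_(a <- A) (\sum_(i < l) f (a + (b j - b k) *+ i)) ^+ 2
    = \sum_i \sum_i' T i i'.
  rewrite /T; under [RHS]eq_bigr do rewrite exchange_big.
  rewrite [RHS]exchange_big; apply: eq_bigr => j _.
  under [RHS]eq_bigr do rewrite exchange_big.
  rewrite [RHS]exchange_big; apply: eq_bigr => k _.
  under [LHS]eq_bigr do rewrite expr2 mulr_suml.
  rewrite [LHS]exchange_big; apply: eq_bigr => i _.
  under [LHS]eq_bigr do rewrite mulr_sumr.
  rewrite [LHS]exchange_big; apply: eq_bigr => i' _.
  by apply: sum_corr => x xO; exact: hA.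
have T0 i i' : 0 <= T i i'.
  (* The shift in [T i i'] is [p k - p j], so [T i i'] is a sum over [y] of the squares of
     [\sum_j f (y + p j)]. *)
  pose p j := b j *+ i - b j *+ i'.
  pose U := [fset x - p j | x in Om, j in 'I_n]%fset.
  rewrite /T (eq_bigr (fun j => \sum_k \sum_(y <- U) f (y + p j) * f (y + p k))); last first.
    move=> j _; apply: eq_bigr => k _; rewrite sum_corr.
      apply: eq_bigr => x _; congr (_ * f (_ + _)).
      rewrite /p !mulrnBl !opprB addrACA [RHS]addrACA; congr (_ + _).
      exact: addrC.
    by move=> x xO; apply/imfset2P; exists x => //; exists j.
  rewrite (eq_bigr (fun j => \sum_(y <- U) \sum_k f (y + p j) * f (y + p k))); last first.
    by move=> j _; rewrite exchange_big.
  rewrite exchange_big; apply: sumr_ge0 => y _.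
  under eq_bigr do rewrite -mulr_sumr.
  by rewrite -mulr_suml -expr2 sqr_ge0.
have Td i : T i i = n%:R ^+ 2 * \sum_(x <- Om) f x ^+ 2.
  rewrite /T; under eq_bigr do under eq_bigr do under eq_bigr do
    rewrite subrr addr0 -expr2.
  by rewrite !sumr_const !card_ord -mulrnA -[LHS]mulr_natl natrM expr2.
rewrite -mulrA mulr_natl; apply: (@le_trans _ _ (\sum_(i < l) T i i)).
  by rewrite (eq_bigr _ (fun i _ => Td i)) sumr_const card_ord.
apply: ler_sum => i _; rewrite (bigD1 i) //= lerDl; apply: sumr_ge0 => i' _.
exact: T0.
Qed.

End Energy.

(** Inside a class modulo [k], subtracting a fixed member and dividing by [k] injects the class into
    [Om]; there are [k ^ d] classes. *)
Lemma residue_card (d k : nat) (A Om : {fset 'rV[int]_d}) : (0 < k)%N ->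
  (forall z z' q, z \in A -> z' \in A -> z = z' + q *+ k -> q \in Om) ->
  (#|` A| <= k ^ d * #|` Om|)%fset%N.
Proof.
case: k => // k _ AO.
pose res (z : 'rV[int]_d) : {ffun 'I_d -> 'I_k.+1} :=
  [ffun j => inord (absz (z 0%R j %% k.+1%:Z)%Z)].
have resP z z' : res z = res z' -> exists q, z = z' + q *+ k.+1.
  move=> e; exists (\row_j ((z 0%R j - z' 0%R j) %/ k.+1%:Z)%Z).
  apply/rowP => j; rewrite mxE mulrnE_row mxE -mulr_natr natz divzK; last first.
    have := congr1 (fun f : {ffun 'I_d -> 'I_k.+1} => f j) e; rewrite !ffunE.
    move=> /(congr1 val) /=.
    have lt x : (absz (x %% k.+1%:Z)%Z < k.+1)%N.
      have := modz_ge0 x (isT : k.+1%:Z != 0); have := ltz_mod x (isT : k.+1%:Z != 0).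
      lia.
    rewrite !inordK ?lt // => /(congr1 Posz).
    rewrite !gez0_abs ?modz_ge0 // => /eqP; rewrite eqz_mod_dvd //.
  by rewrite addrC subrK.
have -> : (k.+1 ^ d * #|` Om|)%fset%N = (\sum_(r : {ffun 'I_d -> 'I_k.+1}) #|` Om|)%fset%N.
  by rewrite sum_nat_const card_ffun !card_ord.
rewrite -sum1_size (partition_big res predT) //=; apply: leq_sum => r _.
rewrite -big_filter sum1_size.
have [z0 z0A|none] := pickP (fun z : A => res (val z) == r); last first.
  rewrite (_ : [seq _ <- _ | _] = [::]) //; apply/eqP.
  rewrite -[_ == _]negbK -has_filter; apply/negP => /hasP[z zA zr].
  by have := none [` zA]%fset; rewrite /= zr.
rewrite -(size_map (fun q => val z0 + q *+ k.+1) Om).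
apply: uniq_leq_size; first by rewrite filter_uniq // fset_uniq.
move=> z; rewrite mem_filter => /andP[/eqP zr zA].
have [q zE] : exists q, z = val z0 + q *+ k.+1 by apply: resP; rewrite zr (eqP z0A).
by apply/mapP; exists q => //; apply: AO zE => //; exact: valP.
Qed.

Section LowerBound.
Context {R : realType} {d : nat} (K : set 'rV[R]_d).
Hypothesis K_body : convex_body K.
Local Notation L := (difference_body K).
Local Notation "z %:v" := (of_int z : 'rV[R]_d) (at level 2, format "z %:v").

Lemma AP_family_mem (Om : {fset 'rV[int]_d}) a b l : (0 < l)%N ->
  [fset x in Om | `[< AP a b l x >]]%fset \in AP_family Om.
Proof.
move=> l0; set S := (X in X \in _).
have SO : S \in fpowerset Om.
  by rewrite fpowersetE; apply/fsubsetP => x; rewrite !inE => /andP[].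
rewrite inE /=; apply/andP; split; first exact: SO.
apply/asboolP; exists a, b, l; split=> //; apply/seteqP; split=> x /=.
  by rewrite !inE => /andP[xO /asboolP].
by move=> [xO xA]; rewrite !inE xO; apply/asboolP.
Qed.

Lemma disc_witness (Om : {fset 'rV[int]_d}) : exists chi : coloring Om,
  forall S, S \in AP_family Om ->
    (`|coloring_sum chi S| <= disc Om (AP_family Om))%N.
Proof.
exists [arg min_(chi < ([ffun=> false] : coloring Om)) coloring_disc (AP_family Om) chi]%N.
move=> S SA; rewrite /disc /coloring_disc.
exact: (leq_bigmax_seq S).
Qed.

Lemma disc_AP_ge (eps : R) (k : nat) v : 0 < eps -> 3 <= k%:R * eps ->
  (forall x, dilate eps L x -> translate v K x) ->
  f_body K <= 4 * Num.sqrt (k%:R ^+ d) * (disc_AP v K)%:R.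
Proof.
move=> e0 ke LK; rewrite /disc_AP; set Om := Omega v K; set D := disc _ _.
have k0 : (0 < k)%N by rewrite lt0n; apply: contraTneq ke => ->; rewrite mul0r; lra.
have kR : 0 < k%:R :> R by rewrite ltr0n.
have [chi chiP] := disc_witness Om; rewrite -/D in chiP.
pose f (x : 'rV[int]_d) : R :=
  if insub x is Some w then (-1) ^+ (chi w : bool) else 0.
have f_supp x : x \notin Om -> f x = 0 by move=> xO; rewrite /f insubN.
have fval (w : Om) : f (val w) = (-1) ^+ chi w by rewrite /f valK.
have f2 x : x \in Om -> f x ^+ 2 = 1.
  by move=> xO; rewrite -[x]/(val [` xO]%fset) fval sqrr_sign.
have sumf2 : \sum_(x <- Om) f x ^+ 2 = (#|` Om|%fset)%:R.
  by rewrite big_seq (eq_bigr (fun=> 1)) // -big_seq -sum1_size natr_sum.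
(* For [b != 0] or [l = 1] the terms of the progression are distinct, so the sum over indices is the
   sum over the set. *)
have sumAP a b l : (0 < l)%N -> b != 0 \/ l = 1%N ->
    `|\sum_(i < l) f (a + b *+ i)| <= D%:R.
  move=> l0 b0; have SA := AP_family_mem Om a b l l0; set S := (X in X \in _) in SA.
  have -> : \sum_(i < l) f (a + b *+ i) = \sum_(w : Om) (-1) ^+ chi w * (val w \in S)%:R.
    under [RHS]eq_bigr do rewrite -fval.
    rewrite -(big_seq_fsetE _ _ predT (fun x => f x * (x \in S)%:R)) /=.
    have -> : \sum_(i < l) f (a + b *+ i) =
        \sum_(i < l) \sum_(x <- Om) f x * (x == a + b *+ i)%:R.
      apply: eq_bigr => i _; have [xO|xO] := boolP (a + b *+ i \in Om); last first.
        rewrite f_supp // big1_seq // => x /andP[_ xO']; case: eqP => [xE|]; last by rewrite mulr0.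
        by rewrite xE (negbTE xO) in xO'.
      rewrite (big_fsetD1 _ xO) /= eqxx mulr1 big1_seq ?addr0 //.
      by move=> x; rewrite !inE => /andP[_ /andP[/negbTE-> _]]; rewrite mulr0.
    rewrite exchange_big big_seq [RHS]big_seq; apply: eq_bigr => x xO.
    rewrite -mulr_sumr; congr (_ * _); rewrite !inE xO /=.
    case: asboolP => [[i /= il xE]|no]; last first.
      by rewrite big1 // => i _; case: eqP => // xE; case: no; exists i => //=.
    rewrite (bigD1 (Ordinal il)) //= xE eqxx big1 ?addr0 // => i' ii'.
    case: eqP => //; rewrite -xE => /addrI /(congr1 row_content); rewrite !content_muln => /eqP e.
    case/eqP: ii'; apply: val_inj; case: b0 => [b0|l1] /=; last first.
      have := ltn_ord i'; move: (i' : nat) il => m; lia.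
    by apply/eqP; rewrite -(eqn_pmul2r (row_content_gt0 _ b0)) eq_sym.
  by rewrite -coloring_sumE ler_nat; exact: chiP.
have D0 : 0 <= D%:R :> R by [].
have O0 : 0 \in Om.
  apply/(OmegaP _ K_body); rewrite of_int0.
  have [|x Kx xE] := LK 0; last by exists x.
  by exists 0; [exact: diff0|rewrite scaler0].
have D1 : 1 <= D%:R :> R.
  have := sumAP 0 0 1%N isT (or_intror erefl); rewrite big_ord1 mul0rn addr0.
  by rewrite -[X in f X]/(val [` O0]%fset) fval normr_sign.
have kd1 : 1 <= Num.sqrt (k%:R ^+ d) :> R.
  by rewrite -[leLHS]sqrtr1 ler_wsqrtr // exprn_ege1 // ler1n.
rewrite /f_body.
(* For small [sstar K], a one-point progression already suffices. *)
have [s4|s4] := ltP (sstar K) 4.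
  apply: (@le_trans _ _ 2).
    apply: (@le_trans _ _ (Num.sqrt (2 ^+ 2))); last by rewrite sqrtr_sqr ger0_norm.
    by apply: ler_wsqrtr; lra.
  by nra.
pose s := sstar K / 2; have s2 : 2 <= s by rewrite /s; lra.
have s0 : 0 < s by lra.
have ss : s < sstar K by rewrite /s; lra.
(* Steps lie in [L] dilated by [2 / s], so fewer than [l <= s / 2] of them move a point by a vector
   of [L]. *)
pose l := Num.truncn (s / 2).
have s20 : 0 <= s / 2 by lra.
have /andP[l1 l2] := truncn_itv s20; rewrite -/l in l1 l2.
have l0 : (0 < l)%N by rewrite lt0n; apply: contraTneq l2 => ->; rewrite -leNgt; lra.
have lR : 1 <= l%:R :> R by rewrite ler1n.
rewrite -[l.+1%:R]natr1 in l2.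
pose B := lattice_points (dilate s^-1 L).
have nB := zeta_gt_below K s s0 ss.
pose n := zeta L s^-1; rewrite -/n in nB.
have n2 : 2 * l%:R <= n%:R :> R by lra.
pose b (j : 'I_n) : 'rV[int]_d := nth 0 B j.
have b_in j : dilate s^-1 L (b j)%:v.
  by apply/(dilate_latticeP _ K_body); rewrite mem_nth.
have b_inj : injective b.
  have lt (i : 'I_n) : (i < size B)%N by exact: ltn_ord i.
  by move=> i j /eqP; rewrite nth_uniq ?fset_uniq // => /eqP /val_inj.
pose E := [set x | exists2 y, K y & exists2 u, L u & x = v + y + u].
have Eb : bounded_set E.
  have [M _ KM] : exists2 M, 0 < M & forall x, K x -> `|x| <= M.
    by apply: bounded_setP; case: K_body.
  have [M' _ LM'] := bounded_setP _ (dilate_bounded _ K_body 1).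
  apply: (bounded_setI _ (`|v| + M + M')) => _ [y Ky [u Lu ->]].
  apply: le_trans (ler_normD _ _) _; apply: lerD; last first.
    by apply: LM'; apply/dilate1.
  by apply: le_trans (ler_normD _ _) _; rewrite lerD2l; exact: KM.
pose A := lattice_points E.
have hA x j1 j2 i : x \in Om -> (i < l)%N -> x - (b j1 - b j2) *+ i \in A.
  move=> /(OmegaP _ K_body)[y Ky yE] il; apply/(lattice_pointsP _ _ Eb).
  exists y => //; exists (- (i%:R *: ((b j1)%:v - (b j2)%:v))).
    apply: diff_opp; apply/dilate1.
    apply: (dilate_mono _ K_body (i%:R * (s^-1 + s^-1))) => //.
    - by rewrite mulr_ge0 // addr_ge0 // invr_ge0 ltW.
    - have il' : i%:R <= l%:R :> R by rewrite ler_nat ltnW.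
      have -> : i%:R * (s^-1 + s^-1) = (i%:R * 2) / s by ring.
      by rewrite ler_pdivrMr // mul1r; lra.
    - apply: dilateZ; apply: (dilateD _ K_body) => //.
      + by rewrite invr_ge0 ltW.
      + by rewrite invr_ge0 ltW.
      + exact: dilateN.
  by rewrite of_intB of_intMn of_intB yE.
(* Starting points lie in [v + K + L], so their differences lie in [3 L], and [3 / k <= eps]. *)
have cardA : (#|` A|%fset)%:R <= k%:R ^+ d * (#|` Om|%fset)%:R :> R.
  rewrite -natrX -natrM ler_nat; apply: residue_card => // z z' q.
  move=> /(lattice_pointsP _ _ Eb)[y Ky [u Lu zE]].
  move=> /(lattice_pointsP _ _ Eb)[y' Ky' [u' Lu' zE']] zq.
  apply/(OmegaP _ K_body); apply: LK.
  apply: (dilate_mono _ K_body (k%:R^-1 * (1 + (1 + 1)))).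
  - by rewrite mulr_ge0 // invr_ge0.
  - rewrite mulrC ler_pdivrMr // mulrC; apply: le_trans ke; lra.
  have -> : q%:v = k%:R^-1 *: ((y - y') + (u + - u')).
    have h : k%:R *: q%:v = z%:v - z'%:v by rewrite zq of_intD of_intMn addrAC subrr add0r.
    have -> : q%:v = k%:R^-1 *: (k%:R *: q%:v).
      by rewrite scalerA mulVf ?scale1r // gt_eqF.
    by rewrite h zE zE' opprD addrACA (opprD v) (addrACA v) subrr add0r.
  apply: dilateZ; apply: (dilateD _ K_body) => //.
    by apply/dilate1; exists y => //; exists y'.
  by apply: (dilateD _ K_body) => //; [|apply: dilateN]; apply/dilate1.
have := energy_ge Om f f_supp A n l b hA; rewrite sumf2.
set N : R := (#|` Om|%fset)%:R in cardA *.
have N0 : 0 < N by rewrite ltr0n cardfs_gt0; apply/fset0Pn; exists 0.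
have diag j : \sum_(a <- A) (\sum_(i < l) f (a + (b j - b j) *+ i)) ^+ 2 = l%:R ^+ 2 * N.
  rewrite -[N]sumf2 -(sum_shift Om A (fun x => f x ^+ 2) 0).
  - rewrite mulr_sumr; apply: eq_bigr => a _.
    rewrite (eq_bigr (fun=> f a)) ?sumr_const ?card_ord.
      by rewrite /= addr0 -[f a *+ l]mulr_natl exprMn.
    by move=> i _; rewrite subrr mul0rn addr0.
  - by move=> x /f_supp->; rewrite expr0n.
  - by move=> x xO; have := hA x j j 0%N xO l0; rewrite mulr0n.
have offdiag j1 j2 : j1 != j2 ->
    \sum_(a <- A) (\sum_(i < l) f (a + (b j1 - b j2) *+ i)) ^+ 2 <=
    k%:R ^+ d * N * D%:R ^+ 2.
  move=> jj; apply: (@le_trans _ _ (\sum_(a <- A) D%:R ^+ 2)).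
    apply: ler_sum => a _; rewrite -[_ ^+ 2]real_normK ?num_real //.
    rewrite lerXn2r ?nnegrE //; apply: sumAP => //; left.
    by rewrite subr_eq0; apply: contra_neq jj; exact: b_inj.
  have -> : \sum_(a <- A) D%:R ^+ 2 = (#|` A|%fset)%:R * D%:R ^+ 2 :> R.
    rewrite (eq_bigr (fun=> 1 * D%:R ^+ 2)) => [|a _]; last by rewrite mul1r.
    by rewrite -mulr_suml -sum1_size natr_sum.
  by rewrite ler_wpM2r ?sqr_ge0.
move=> energy.
have main : l%:R * n%:R ^+ 2 * N <= n%:R * (l%:R ^+ 2 * N) + n%:R ^+ 2 * (k%:R ^+ d * N * D%:R ^+ 2).
  apply: le_trans energy _.
  apply: (@le_trans _ _ (\sum_(j1 < n) (l%:R ^+ 2 * N + \sum_(j2 < n) k%:R ^+ d * N * D%:R ^+ 2))).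
    apply: ler_sum => j1 _; rewrite (bigD1 j1) //= diag lerD2l.
    rewrite [leRHS](bigD1 j1) //= -[leLHS]add0r; apply: lerD.
      by rewrite !mulr_ge0 ?exprn_ge0 // ltW.
    by apply: ler_sum => j2 jj; apply: offdiag; rewrite eq_sym.
  rewrite big_split /= !sumr_const !card_ord -mulrnA.
  by rewrite -[_ *+ n]mulr_natl -[_ *+ (n * n)]mulr_natl natrM -expr2.
have n0 : 0 < n%:R :> R by lra.
have kD : 0 <= k%:R ^+ d * D%:R ^+ 2 :> R by rewrite mulr_ge0 ?exprn_ge0.
have {}main : l%:R * n%:R <= l%:R ^+ 2 + n%:R * (k%:R ^+ d * D%:R ^+ 2) :> R.
  rewrite -(ler_pM2r N0) -(ler_pM2r n0); apply: le_trans (le_trans _ main) _.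
    by rewrite le_eqVlt; apply/orP; left; apply/eqP; ring.
  by rewrite le_eqVlt; apply/orP; left; apply/eqP; ring.
(* Since [n >= 2 * l], the step 0 accounts for at most half of the energy. *)
have lkD : l%:R <= 2 * (k%:R ^+ d * D%:R ^+ 2) :> R.
  rewrite -(ler_pM2r n0); move: main; set q := k%:R ^+ d * D%:R ^+ 2.
  by move: (n%:R : R) (l%:R : R) n2 lR => x y; nra.
have -> : 4 * Num.sqrt (k%:R ^+ d) * D%:R = Num.sqrt (16 * (k%:R ^+ d * D%:R ^+ 2)) :> R.
  rewrite sqrtrM // sqrtrM ?exprn_ge0 // sqrtr_sqr ger0_norm // mulrA; congr (_ * _ * _).
  have -> : 16 = 4 ^+ 2 :> R by ring.
  by rewrite sqrtr_sqr ger0_norm.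
apply: ler_wsqrtr; move: lkD; rewrite /s in l2; lra.
Qed.

End LowerBound.

(** * An inscribed simplex *)

(** Cramer's rule: the cofactors along row [i] do not see that row. *)
Lemma det_replace_row (R : comNzRingType) (n : nat) (A B : 'M[R]_n) (u : 'rV[R]_n) i :
  row i B = u -> row' i B = row' i A -> \det B = (u *m \adj A) 0 i.
Proof.
move=> Bi B'; rewrite (expand_det_row _ i) mxE; apply: eq_bigr => j _.
rewrite [in RHS]mxE -Bi [in RHS]mxE; congr (_ * _).
have swap (C : 'M[R]_n) : row' i (col' j C) = col' j (row' i C).
  by apply/matrixP => k l; rewrite !mxE.
by rewrite /cofactor !swap B'.
Qed.

Section Simplex.
Context {R : realType} {d : nat} (K : set 'rV[R]_d).
Hypothesis K_body : convex_body K.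

(** Homogeneous coordinates: the absolute determinant is [d!] times the volume of the simplex. *)
Definition simplex_mx (p : 'I_(1 + d) -> 'rV[R]_d) : 'M[R]_(1 + d) :=
  \matrix_(i < 1 + d) row_mx (1 : 'M[R]_1) (p i).

Lemma row_simplex_mx p i : row i (simplex_mx p) = row_mx 1 (p i).
Proof. exact: rowK. Qed.

Lemma simplex_mx0 p i : simplex_mx p i (lshift d 0) = 1.
Proof. by rewrite mxE row_mxEl mxE. Qed.

Lemma simplex_mxS p i j : simplex_mx p i (rshift 1 j) = p i 0 j.
Proof. by rewrite mxE row_mxEr. Qed.

Lemma convex_sum (I : finType) (m : I -> R) (p : I -> 'rV[R]_d) :
  (forall i, 0 <= m i) -> \sum_i m i = 1 -> (forall i, K (p i)) ->
  K (\sum_i m i *: p i).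
Proof.
move=> m0 m1 Kp; have [k0 Kk0] := body_nonempty _ K_body.
have [_ [k Kk ->]] : 0 <= \sum_i m i /\
    exists2 k, K k & \sum_i m i *: p i = (\sum_i m i) *: k.
  apply: (big_ind2 (fun x s => 0 <= s /\ exists2 k, K k & x = s *: k)).
  - by split=> //; exists k0 => //; rewrite scale0r.
  - move=> x s y t [s0 [k Kk ->]] [t0 [l Kl ->]]; split; first exact: addr_ge0.
    have [st|st] := eqVneq (s + t) 0.
      have [-> ->] : s = 0 /\ t = 0 by split; lra.
      by exists k0 => //; rewrite !scale0r !addr0 scale0r.
    have stp : 0 < s + t by rewrite lt_def st addr_ge0.
    exists ((s / (s + t)) *: k + (1 - s / (s + t)) *: l).
      apply: (body_conv _ K_body) => //; first by rewrite divr_ge0 // ltW.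
      by rewrite ler_pdivrMr // mul1r lerDl.
    by rewrite scalerDr !scalerA; congr (_ *: _ + _ *: _); field.
  - by move=> i _; split=> //; exists (p i).
by rewrite m1 scale1r.
Qed.

Lemma simplex_det_bounded : exists B, forall p, (forall i, K (p i)) ->
  `|\det (simplex_mx p)| <= B.
Proof.
have [M M0 KM] : exists2 M, 0 < M & forall x, K x -> `|x| <= M.
  by apply: bounded_setP; case: K_body.
exists (\sum_(s : 'S_(1 + d)) (1 + M) ^+ (1 + d)) => p Kp.
apply: le_trans (ler_norm_sum _ _ _) _; apply: ler_sum => s _.
rewrite normrM normr_sign mul1r normr_prod -[X in _ ^+ X]card_ord -prodr_const.
apply: ler_prod => i _; rewrite normr_ge0 /=.
case: (split_ordP (s i)) => j ->.
  by rewrite ord1 simplex_mx0 normr1 lerDl ltW.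
rewrite simplex_mxS; apply: le_trans (entry_le_norm _ j) _.
by apply: le_trans (KM _ (Kp i)) _; rewrite lerDr.
Qed.

(** The vertices are an interior point and small moves of it along the axes. A kernel vector of the
    transpose is an affine function vanishing at all of them, hence zero. *)
Lemma nondegenerate_simplex : exists2 p, (forall i, K (p i)) &
  \det (simplex_mx p) != 0.
Proof.
case: K_body => _ _ _ [x0 /nbhs_ballP[r /= r0 xr]].
pose t (j : 'I_d) : R := r / (2 * (`|delta_mx 0 j : 'rV[R]_d| + 1)).
have tp j : 0 < t j by rewrite divr_gt0 // mulr_gt0 // ltr_wpDl.
have Kx0 : K x0 by apply: xr; exact: ballxx.
have Kt j : K (x0 + t j *: delta_mx 0 j).
  apply: xr; rewrite -ball_normE /ball_ /= opprD addrA subrr sub0r normrN normrZ.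
  rewrite (gtr0_norm (tp j)) /t mulrAC ltr_pdivrMr ?mulr_gt0 ?ltr_wpDl //.
  by rewrite ltr_pM2l //; have := normr_ge0 (delta_mx 0 j : 'rV[R]_d); lra.
pose p (i : 'I_(1 + d)) := match fintype.split i with
  | inl _ => x0 | inr j => x0 + t j *: delta_mx 0 j end.
exists p; first by move=> i; rewrite /p; case: (fintype.split i).
rewrite -det_tr; apply/det0P => -[u u0 uM].
have uE i : u 0 (lshift d 0) + \sum_j u 0 (rshift 1 j) * p i 0 j = 0.
  have := congr1 (fun w : 'rV[R]_(1 + d) => w 0 i) uM; rewrite !mxE big_split_ord /=.
  rewrite big_ord1 mxE simplex_mx0 mulr1 => h; rewrite -[RHS]h; congr (_ + _).
  by apply: eq_bigr => j _; rewrite [in RHS]mxE simplex_mxS.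
have e0 := uE (lshift d 0); have pl : p (lshift d 0) = x0 by rewrite /p (unsplitK (inl _)).
have u1 j : u 0 (rshift 1 j) = 0.
  have := uE (rshift 1 j); have -> : p (rshift 1 j) = x0 + t j *: delta_mx 0 j.
    by rewrite /p (unsplitK (inr _)).
  move: e0; rewrite pl => e0.
  under eq_bigr do rewrite mxE mulrDr; rewrite big_split /= addrA e0 add0r.
  rewrite (bigD1 j) //= big1 => [|i ij]; last by rewrite !mxE (negbTE ij) andbF !mulr0.
  rewrite !mxE !eqxx mulr1 addr0 => /eqP.
  by rewrite mulf_eq0 (gt_eqF (tp j)) orbF => /eqP.
case/eqP: u0; apply/rowP => i; rewrite mxE.
case: (split_ordP i) => j ->; last exact: u1.
move: e0; rewrite big1 ?addr0 ?ord1 // => i' _; by rewrite u1 mul0r.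
Qed.

(* In a simplex of nearly maximal volume among those with vertices in [K], the
   barycentric coordinates of the points of [K] are at most 2 in absolute
   value, so the barycentre absorbs a small multiple of [K - K]. *)
Lemma inner_difference_body : exists v, forall x,
  dilate (4 * (1 + d)%:R)^-1 (difference_body K) x -> translate v K x.
Proof.
pose S : set R := [set `|\det (simplex_mx p)| | p in [set p | forall i, K (p i)]].
have [p0 Kp0 det0] := nondegenerate_simplex.
have [B SB] := simplex_det_bounded.
have S0 : S !=set0 by exists `|\det (simplex_mx p0)|, p0.
have Sb : has_ubound S by exists B => _ [p Kp <-]; exact: SB.
have supS : 0 < sup S.
  apply: lt_le_trans (_ : `|\det (simplex_mx p0)| <= _); first by rewrite normr_gt0.
  by apply: ub_le_sup => //; exists p0.
have [|_ [p Kp <-] pS] := @sup_gt _ S (sup S / 2) S0; first lra.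
set A := simplex_mx p in pS.
have detA : 0 < `|\det A| by lra.
have unitA : A \in unitmx by rewrite unitmxE unitfE -normr_gt0.
pose bary (y : 'rV[R]_d) i := (row_mx (1 : 'M[R]_1) y *m invmx A) 0 i.
have baryE y : \sum_i bary y i = 1 /\ \sum_i bary y i *: p i = y.
  have h : row_mx (1 : 'M[R]_1) y *m invmx A *m A = row_mx 1 y by rewrite mulmxKV.
  split.
    have := congr1 (fun w : 'rV[R]_(1 + d) => w 0 (lshift d 0)) h.
    rewrite row_mxEl [in X in _ = X -> _]mxE eqxx mxE => s1; rewrite -[RHS]/(true%:R) -s1.
    by apply: eq_bigr => i _; rewrite simplex_mx0 mulr1.
  apply/rowP => j.
  have := congr1 (fun w : 'rV[R]_(1 + d) => w 0 (rshift 1 j)) h.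
  rewrite row_mxEr mxE => <-; rewrite summxE.
  by apply: eq_bigr => i _; rewrite simplex_mxS mxE.
have bary2 y i : K y -> `|bary y i| <= 2.
  (* Putting [y] in place of vertex [i] multiplies the determinant by [bary y i]. *)
  move=> Ky; pose q k := if k == i then y else p k.
  have E : \det A * bary y i = \det (simplex_mx q).
    rewrite (@det_replace_row _ _ A (simplex_mx q) (row_mx 1 y) i).
    - rewrite /bary /invmx unitA -scalemxAr mxE mulrA mulfV ?mul1r //.
      by rewrite -normr_gt0.
    - by rewrite row_simplex_mx /q eqxx.
    - apply/matrixP => k l; rewrite !mxE /q [lift i k == i]eq_sym.
      by rewrite (negbTE (neq_lift i k)).
  rewrite -(ler_pM2l detA) -normrM E.
  apply: (@le_trans _ _ (sup S)); last lra.
  apply: ub_le_sup => //; exists q => // k; rewrite /q; by case: ifP.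
have d1 : 0 < (1 + d)%:R :> R by rewrite ltr0n.
exists (- \sum_i (1 + d)%:R^-1 *: p i) => _ [_ [y Ky [z Kz <-]] <-].
set e := (4 * _)^-1.
(* The barycentric coordinates [1 / (1 + d)] change by at most [4 * e = 1 / (1 + d)], so they stay
   nonnegative. *)
exists (\sum_i ((1 + d)%:R^-1 + e * (bary y i - bary z i)) *: p i).
  have [y1 _] := baryE y; have [z1 _] := baryE z.
  apply: convex_sum => //.
    move=> i; have := bary2 y i Ky; have := bary2 z i Kz.
    rewrite !ler_norml => /andP[z2 z3] /andP[y2 y3].
    have -> : (1 + d)%:R^-1 = e * 4 by rewrite /e; field; rewrite gt_eqF.
    rewrite -mulrDr mulr_ge0 //; last lra.
    by rewrite invr_ge0 mulr_ge0 // ltW.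
  rewrite big_split /= sumr_const card_ord -mulr_sumr sumrB y1 z1 subrr mulr0 addr0.
  by rewrite -[LHS]mulr_natr mulVf // gt_eqF.
have [_ yE] := baryE y; have [_ zE] := baryE z.
rewrite -{2}yE -{2}zE.
under [X in - _ + X]eq_bigr do rewrite scalerDl -scalerA scalerBl.
by rewrite big_split /= addrA addNr add0r -scaler_sumr sumrB.
Qed.

End Simplex.

(** * The two-sided estimate *)

Theorem theorem1p3 (R : realType) (d : nat) (d_gt0 : (0 < d)%N) :
  exists c C : R, 0 < c /\ 0 < C /\
    forall K : set 'rV[R]_d, convex_body K ->
      ((f_body K)%:E <=
         c%:E * ereal_sup [set (disc_AP v K)%:R%:E | v in [set: 'rV[R]_d]])%E
      /\ (forall v : 'rV[R]_d,
            (disc_AP v K)%:R <=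
              C * Num.sqrt (ln (1 + (#|` Omega v K|%fset)%:R)) * f_body K)
      /\ (K = [set - x | x in K] ->
            f_body K <= c * (disc_AP 0 K)%:R /\
            c * (disc_AP 0 K)%:R <=
              c * C * Num.sqrt (ln (1 + (#|` Omega 0 K|%fset)%:R)) * f_body K).
Proof.
(* [e] comes from [inner_difference_body], and [k] makes [k * e = 3], as [disc_AP_ge] requires. *)
pose k := (12 * (1 + d))%N; pose e : R := (4 * (1 + d)%:R)^-1.
pose c : R := 4 * Num.sqrt (k%:R ^+ d).
have d1 : 0 < (1 + d)%:R :> R by rewrite ltr0n.
have e0 : 0 < e by rewrite invr_gt0 mulr_gt0.
have ke : 3 <= k%:R * e.
  by rewrite /k /e natrM le_eqVlt; apply/orP; left; apply/eqP; field; rewrite gt_eqF.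
have c0 : 0 < c.
  by rewrite mulr_gt0 // sqrtr_gt0 exprn_gt0 // ltr0n /k muln_gt0.
exists c, 320; split; first exact: c0.
split; first by rewrite ltr0n.
move=> K K_body; split; last split.
- have [v Kv] := inner_difference_body K K_body.
  have h := disc_AP_ge K K_body e k v e0 ke Kv.
  apply: le_trans (_ : (c%:E * (disc_AP v K)%:R%:E <= _)%E).
    by rewrite -EFinM lee_fin.
  by rewrite lee_pmul2l // ereal_sup_ubound //; exists v.
- exact: disc_AP_le.
- move=> KN; split.
    apply: (disc_AP_ge K K_body e k 0 e0 ke) => x Lx.
    have e2 : e <= 1 / 2.
      rewrite /e -[1 / 2]invf_div divr1 lef_pV2 ?posrE ?mulr_gt0 //.
      have : 1 <= (1 + d)%:R :> R by rewrite ler1n.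
      lra.
    have [_ [y Ky [z Kz <-]] <-] := dilate_mono K K_body e (1 / 2) x (ltW e0) e2 Lx.
    have Kz' : K (- z) by rewrite KN; exists z.
    exists ((1 / 2) *: y + (1 - 1 / 2) *: - z); first by apply: body_conv => //; lra.
    by rewrite add0r scalerBr scalerN; congr (_ - _ *: _); lra.
  by apply: le_trans (ler_wpM2l (ltW c0) (disc_AP_le K K_body 0)) _; rewrite !mulrA.
Qed.
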